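(* Let $n\ge 2$ and $l\ge 1$ be integers. Then $$K_{n-2}^{l+1}=K_n^l-nl\,K_n^{l-1},$$ where $K_n^l$ denotes the number of connected components of the set of very nice M-morsifications of the multiboundary singularity $B_n^l$.
   Context: For an integer $n\ge 1$ let $P_n$ be the space of real polynomials of the form $x^n+\lambda_2x^{n-2}+\cdots+\lambda_{n-1}x$, with the topology of the coefficients $\lambda_i\in\mathbb R$ (so $P_1=\{x\}$, $P_2=\{x^2\}$). For $l\ge 0$ consider pairs $(f;b_1,\dots,b_l)\in P_n\times\mathbb R^l$; the $b_i$ are the (labelled) boundary points and the numbers $f(b_i)$ are the boundary values. Such a pair is a very nice M-morsification of $B_n^l$ if all $n-1$ critical points of $f$ (counted with multiplicity) are real and the $n-1$ critical values together with the $l$ boundary values are all pairwise distinct. $K_n^l$ is the number of connected components of the set of very nice M-morsifications of $B_n^l$, as a subspace of $P_n\times\mathbb R^l$. For $n=0$, $K_0^l$ (for $l\ge1$) is the number of connected components of the space of degree $0$ polynomials (the zero polynomial) with $l$ labelled real boundary points having pairwise distinct boundary values; thus $K_0^1=1$ and $K_0^l=0$ for $l\ge 2$. *)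

(* Defs.v *)
From HB Require Import structures.
From mathcomp Require Import all_boot all_order all_algebra.
From mathcomp Require Import finmap.
From mathcomp Require Import all_classical all_reals all_analysis.
Set Implicit Arguments.
Unset Strict Implicit.
Unset Printing Implicit Defensive.
Import Order.TTheory GRing.Theory Num.Theory.
Import numFieldNormedType.Exports.
Local Open Scope classical_set_scope.
Local Open Scope ring_scope.

(* P_n x R^l; lam 0 i is the coefficient lambda_(i + 2), so that the topology
   of P_n is the product topology on its (n - 2)-tuples of coefficients
   (P_0, P_1 and P_2 are singletons). *)
Notation morsif R n l := ('rV[R]_(n - 2) * 'rV[R]_l)%type.

(* x^n + lambda_2 x^(n-2) + ... + lambda_(n-1) x, and the zero polynomial when
   n = 0 (not 'X^0 = 1). *)
Definition Pn_poly (R : realType) (n : nat) (lam : 'rV[R]_(n - 2)) : {poly R} :=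
  if n == 0%N then 0
  else 'X^n + \sum_(i < n - 2) lam 0 i *: 'X^(n - 2 - i).
Arguments Pn_poly {R} n lam.

(* cs lists, with multiplicity, the critical points of f, all of them real:
   f' splits over R with cs as its roots. When f = 0 this holds for every cs,
   so the length of cs has to be imposed separately. *)
Definition real_critical_points (R : realType) (f : {poly R}) (cs : seq R) :=
  f^`() = lead_coef f^`() *: \prod_(c <- cs) ('X - c%:P).

(* For n = 0 the tuple cs is empty (0.-1 = 0), and only the boundary values
   are required to be pairwise distinct. *)
Definition very_nice_M (R : realType) (n l : nat) : set (morsif R n l) :=
  [set p : morsif R n l | exists2 cs : n.-1.-tuple R,
     real_critical_points (Pn_poly n p.1) cs &
     uniq ([seq (Pn_poly n p.1).[c] | c <- cs] ++
           [seq (Pn_poly n p.1).[p.2 0 i] | i <- enum 'I_l])].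
Arguments very_nice_M R n l p : clear implicits.

Definition components (T : topologicalType) (A : set T) : set (set T) :=
  [set connected_component A x | x in A].

(* fset_set is empty on infinite sets: K is meaningful only when the set of
   components is finite. *)
Definition K (R : realType) (n l : nat) : nat :=
  #|` fset_set (components (very_nice_M R n l))|.

(* Main.v *)
Require Import Defs.
From HB Require Import structures.
From mathcomp Require Import all_boot all_order all_algebra.
From mathcomp Require Import polyrcf ring lra zify.
From mathcomp Require Import finmap.
From mathcomp Require Import all_classical all_reals all_analysis.
Set Implicit Arguments.
Unset Strict Implicit.
Unset Printing Implicit Defensive.
Import Order.TTheory GRing.Theory Num.Theory.
Import numFieldNormedType.Exports.
Local Open Scope classical_set_scope.
Local Open Scope ring_scope.

(* Mark the n - 1 critical points and the l boundary points of a very nice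
   morsification on the x-axis, from left to right, and record the ranks of
   their values: this gives a permutation w of m = n + l - 1 ranks. Completed by
   +oo on the right and by (-1)^n oo on the left, w has n monotone runs (laps):
   its peaks and valleys are the critical points, the other entries are the
   boundary points. The connected components correspond to the pairs (w, b),
   where b labels the l entries that are not extremal, so K_n^l = l! A(m, n)
   with A(m, n) the number of such w having n laps. Inserting a new minimum into
   a word with n laps keeps the number of laps in n of the m + 1 places and adds
   2 in the others, whence A(m + 1, n) = n A(m, n) + (m + 3 - n) A(m, n - 2),
   which is the claim.

   That the pairs (w, b) do classify the components rests on a theorem of Thom:
   the spacings between the marked points depend continuously and bijectively on
   the gaps between consecutive values. The gaps are converted one at a time, so
   only the intermediate value theorem is needed, provided that a gap increases
   with its spacing when the spacings on its left and the gaps on its right are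
   fixed. It suffices to prove this locally: there, a failure would give the
   derivative of the difference of the two polynomials, which has degree less
   than n - 1, at least n - 1 roots by Rolle's theorem. *)

(** * Counting words by number of laps *)

Section Words.
Local Open Scope nat_scope.

Fixpoint changes (b : bool) (s : seq bool) : nat :=
  if s is c :: s' then (b != c) + changes c s' else 0.

Lemma changes_cat b s1 s2 :
  changes b (s1 ++ s2) = changes b s1 + changes (last b s1) s2.
Proof. by elim: s1 b => //= c s IH b; rewrite IH addnA. Qed.

Lemma changesE b s :
  changes b s = count (fun i => nth true (b :: s) i != nth true (b :: s) i.+1)
                      (iota 0 (size s)).
Proof.
elim: s b => //= c s IH b; rewrite IH -[1]/(1 + 0) iotaDl count_map.
by congr (_ + _); apply: eq_count.
Qed.

(* Directions of the word w completed by (-1)^n oo on the left and by +oo on the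
   right: entry i says whether the i-th step goes up. *)
Definition sig (n : nat) (w : seq nat) : seq bool :=
  odd n :: if w is x :: s then rcons (pairmap ltn x s) true else [::].

Definition ext (n : nat) (w : seq nat) (i : nat) : bool :=
  nth true (sig n w) i != nth true (sig n w) i.+1.

Definition laps (n : nat) (w : seq nat) : nat :=
  (count (ext n w) (iota 0 (size w))).+1.

Lemma size_sig n w : size (sig n w) = (size w).+1.
Proof. by case: w => //= x s; rewrite size_rcons size_pairmap. Qed.

Lemma laps_changes n w : laps n w = (changes (odd n) (behead (sig n w))).+1.
Proof.
by rewrite changesE /laps -[odd n :: _]/(sig n w) size_behead size_sig.
Qed.

Lemma nth_sig n w i : i.+1 < size w ->
  nth true (sig n w) i.+1 = (nth 0 w i < nth 0 w i.+1).
Proof.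
case: w => // x s /= hi.
by rewrite nth_rcons size_pairmap -ltnS hi (nth_pairmap 0).
Qed.

Lemma nth_sig_ge n w i : 0 < i -> size w <= i -> nth true (sig n w) i = true.
Proof.
case: i => // i _; case: w => [|x s] /= hi; first by rewrite nth_nil.
by rewrite nth_rcons size_pairmap ltnNge -ltnS hi /=; case: ifP.
Qed.

Definition insert_min (p : nat) (w : seq nat) : seq nat :=
  map S (take p w) ++ 0 :: map S (drop p w).

Lemma pairmap_ltnS x s : pairmap ltn x.+1 (map S s) = pairmap ltn x s.
Proof. by elim: s x => //= y s IH x; rewrite IH. Qed.

(* d is the list of directions of a word; step p is the one that gets split by
   the insertion of the new minimum. *)
Definition keeps_laps (d : nat -> bool) (p : nat) : bool :=
  (d p && ((p == 0) || ~~ d p.-1)) || (~~ d p && d p.+1).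

(** The new minimum turns step [p] into a descent followed by an ascent, and only the neighbouring
    steps matter for the turns. At [p = 0] the step coming from infinity keeps its direction and an
    ascent follows it. *)
Lemma laps_insert_min n w p : 0 < size w -> p <= size w ->
  laps n (insert_min p w) =
    laps n w + (~~ keeps_laps (nth true (sig n w)) p).*2.
Proof.
move=> w0 pw; rewrite !laps_changes -{2 3}(cat_take_drop p w) /insert_min.
have sp : size (take p w) = p by rewrite size_take_min; apply/minn_idPl.
move: (take p w) (drop p w) sp (cat_take_drop p w) => a b <- {p pw} eqw.
case: a eqw => [|x a] eqw.
  case: b eqw w0 => [<- //|x s] eqw _ /=.
  rewrite pairmap_ltnS.
  by case: s eqw => [|y s] eqw /=; rewrite /keeps_laps /=;
    case: (odd n) => //=; try case: (x < y) => //=; lia.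
rewrite /keeps_laps /= !pairmap_cat /= !rcons_cat /=.
rewrite pairmap_ltnS last_map.
set A := pairmap ltn x a.
have sA : size A = size a by rewrite size_pairmap.
have nl : nth true (sig n (x :: a ++ b)) (size a) = last (odd n) A.
  rewrite /sig pairmap_cat rcons_cat -cat_cons nth_cat /= sA ltnSn -sA.
  by rewrite -[size A]/((size (odd n :: A)).-1) nth_last.
rewrite nl !changes_cat /=.
case: b eqw {nl} => [|z b] eqw /=.
  rewrite !nth_cat sA ltnn subnn /=.
  by case: (last _ _) => /=; lia.
rewrite pairmap_ltnS !nth_cat sA ltnn subnn /= [(size a).+1 < _]ltnNge leqnSn.
rewrite /= subSn // subnn /=; case: (pairmap ltn z b) => [|c s] /=.
  by case: (last _ _); case: (_ < z) => /=; lia.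
by case: (last (odd n) _); case: (last x a < z); case: c => /=; lia.
Qed.

(** Turns from descent to ascent alternate with turns from ascent to descent, so the two numbers
    differ only by the end values [d 0] and [d m]. *)
Lemma changes_count (d : nat -> bool) m :
  let up := \sum_(i < m) (~~ d i && d i.+1) in
  (\sum_(i < m) (d i != d i.+1) + d m = up.*2 + d 0)%N.
Proof.
elim: m => [|m IH] /=; first by rewrite !big_ord0.
rewrite !big_ord_recr /=; move: IH => /=.
by case: (d m); case: (d m.+1) => /=; lia.
Qed.

(** Each lap contains exactly one good place: its first step if it ascends, its last step if it
    descends. A descending lap is always followed by an ascent because [d m] holds. *)
Lemma sum_keeps_laps (d : nat -> bool) m : d m ->
  \sum_(p < m.+1) keeps_laps d p = (\sum_(i < m) (d i != d i.+1)).+1.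
Proof.
move=> dm; have := changes_count d m; rewrite dm /= => e.
have -> : \sum_(p < m.+1) keeps_laps d p =
   \sum_(p < m.+1) (d p && ((p == 0 :> nat) || ~~ d p.-1))%N +
   \sum_(p < m.+1) (~~ d p && d p.+1)%N.
  rewrite -big_split /=; apply: eq_bigr => i _.
  by rewrite /keeps_laps; case: (d i) => //=; rewrite orbF addn0.
rewrite big_ord_recl big_ord_recr dm /= addn0 andbT.
under eq_bigr => i _ do rewrite /bump add1n /= andbC.
by move: e; set u := \sum_(i < m) (~~ _ && _); lia.
Qed.

Definition num_words (m n : nat) : nat :=
  count (fun w => laps n w == n) (permutations (iota 0 m)).

Lemma insert_min_inj p q w v : p <= size w -> q <= size v ->
  insert_min p w = insert_min q v -> p = q /\ w = v.
Proof.
move=> pw qv.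
have ix r u : r <= size u -> index 0 (insert_min r u) = r.
  move=> ru; rewrite index_cat /=.
  have -> : 0 \in map S (take r u) = false by apply/mapP; case.
  by rewrite addn0 size_map size_take_min; apply/minn_idPl.
have fl r u : map predn (rem 0 (insert_min r u)) = u.
  rewrite /insert_min remE index_cat /=.
  have -> : 0 \in map S (take r u) = false by apply/mapP; case.
  rewrite addn0 take_size_cat // drop_cat ltnNge leqnSn /= subSn // subnn /= drop0.
  rewrite map_cat -!map_comp -[RHS](cat_take_drop r) .
  by congr (_ ++ _); rewrite -[RHS]map_id; apply: eq_map.
by move=> e; split; [rewrite -(ix p w) // e ix | rewrite -(fl p w) e fl].
Qed.

Lemma perm_insert_min p w m : p <= m ->
  perm_eq w (iota 0 m) -> perm_eq (insert_min p w) (iota 0 m.+1).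
Proof.
move=> pm pw; rewrite perm_catC /= perm_cons perm_catC -map_cat cat_take_drop.
by rewrite -[1]/(1 + 0) iotaDl; apply: perm_map.
Qed.

(** The inverse of the insertion removes 0 and lowers the other entries by 1. *)
Lemma permutations_iotaS m :
  perm_eq (permutations (iota 0 m.+1))
    [seq insert_min p w | w <- permutations (iota 0 m), p <- iota 0 m.+1].
Proof.
have szw w : w \in permutations (iota 0 m) -> size w = m.
  by rewrite mem_permutations => /perm_size; rewrite size_iota.
have memI p : (p \in 0 :: iota 1 m) = (p <= m).
  by rewrite -[0 :: _]/(iota 0 m.+1) mem_iota ltnS.
apply: uniq_perm; first exact: permutations_uniq.
  apply: allpairs_uniq; [exact: permutations_uniq|exact: iota_uniq|].
  move=> [w p] [v q] /allpairsP[[w' p'] [w'P p'P [-> ->]]].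
  move=> /allpairsP[[v' q'] [v'P q'P [-> ->]]].
  move: w'P p'P v'P q'P; rewrite /fst /snd /= !memI => w'P p'P v'P q'P e.
  by case: (insert_min_inj _ _ e); rewrite ?(szw w') ?(szw v') // => -> ->.
move=> v; rewrite mem_permutations; apply/idP/allpairsP => [pv|]; last first.
  move=> [[w p] /= [wP pP ->]]; apply: perm_insert_min.
    by rewrite -memI.
  by rewrite -mem_permutations.
have v0 : 0 \in v by rewrite (perm_mem pv) mem_iota.
have vu : uniq v by rewrite (perm_uniq pv) iota_uniq.
move: pv vu; case/splitPr: v0 => a b pv vu.
have [a0 b0] : (0 \notin a) /\ (0 \notin b).
  move: vu; rewrite cat_uniq /= => /and3P[_ /norP[-> _]] /andP[]//.
have SP s : 0 \notin s -> map S (map predn s) = s.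
  move=> s0; rewrite -map_comp -[RHS]map_id; apply/eq_in_map => x xs /=.
  by rewrite prednK // lt0n; apply: contraNneq s0 => <-.
exists (map predn (a ++ b), size a); split => /=; last 1 first.
- rewrite /insert_min map_cat take_size_cat ?size_map // drop_size_cat ?size_map //.
  by rewrite !SP.
- rewrite mem_permutations; apply: (perm_map_inj succn_inj).
  rewrite SP ?mem_cat ?negb_or ?a0 //; move: pv.
  by rewrite perm_catC /= perm_cons perm_catC -[1]/(1 + 0) iotaDl.
- rewrite memI; move: (perm_size pv).
  by rewrite size_cat /= size_iota addnS => -[<-]; rewrite leq_addr.
Qed.

Lemma laps_odd n n' w : odd n = odd n' -> laps n w = laps n' w.
Proof. by rewrite !laps_changes /sig => ->. Qed.

Lemma num_wordsS m n : 0 < m -> 1 < n ->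
  num_words m.+1 n = n * num_words m n + (m + 3 - n) * num_words m (n - 2).
Proof.
(* A word with [L] laps has [L] places that keep this number and [m.+1 - L] that raise it by 2, so
   it yields words with [n] laps only when [L] is [n] or [n - 2]. [bE] treats one place, [fE] the
   sum over all places. *)
have bE (k : bool) (L : nat) : 1 < n -> (if L + (~~ k).*2 == n then 1 else 0) =
    (L == n) * k + (L == n - 2) * ~~ k.
  move=> n1; case: k; rewrite /= ?muln0 ?muln1 ?addn0; first by case: eqP.
  have -> : (L + 2 == n) = (L == n - 2) by apply/eqP/eqP; lia.
  by case: eqP.
have fE L : 1 < n -> L <= m.+1 -> (L == n) * L + (L == n - 2) * (m.+1 - L) =
    (L == n) * n + (L == n - 2) * (m + 3 - n).
  by move=> n1 Ln; (case: (L =P n) => e1); (case: (L =P n - 2) => e2) => /=; lia.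
move=> m0 n1; rewrite /num_words (permP (permutations_iotaS m)).
rewrite count_flatten -map_comp sumnE big_map.
rewrite -!sum1_count.
have <- : \sum_(w <- permutations (iota 0 m))
    ((laps n w == n) * n + (laps n w == n - 2) * (m + 3 - n)) =
    n * \sum_(w <- permutations (iota 0 m) | laps n w == n) 1 +
    (m + 3 - n) * \sum_(w <- permutations (iota 0 m) | laps (n - 2) w == n - 2) 1.
  rewrite big_split /= ![\sum_(_ <- _ | _) _]big_mkcond /=.
  rewrite !big_distrr /=; congr (_ + _); apply: eq_bigr => w _.
    by case: eqP => _; rewrite ?muln1 ?muln0 ?mul1n ?mul0n.
  (* As [n] and [n - 2] have the same parity, both complete [w] by the same infinity on the left. *)
  rewrite (@laps_odd (n - 2) n) ?oddB // ?addbF //.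
  by case: eqP => _; rewrite ?muln1 ?muln0 ?mul1n ?mul0n.
rewrite !big_seq; apply: eq_bigr => w.
rewrite mem_permutations => pw.
have sw : size w = m by rewrite (perm_size pw) size_iota.
rewrite [LHS](count_map (insert_min^~ w) _ (iota 0 m.+1)) -sum1_count big_mkcond.
rewrite -[iota 0 m.+1]/(index_iota 0 m.+1) big_mkord.
have dm : nth true (sig n w) m by rewrite nth_sig_ge // ?sw.
have sk := sum_keeps_laps dm.
have lw : laps n w = \sum_(p < m.+1) keeps_laps (nth true (sig n w)) p.
  rewrite sk /laps sw -sum1_count big_mkcond -[X in iota _ X]subn0.
  rewrite -/(index_iota 0 m) big_mkord.
  by congr _.+1; apply: eq_bigr => i _; rewrite -/(ext n w i); case: (ext n w i).
have sc : \sum_(p < m.+1) ~~ keeps_laps (nth true (sig n w)) p + laps n w = m.+1.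
  rewrite lw -big_split /= (eq_bigr (fun=> 1)) ?sum1_card ?card_ord // => p _.
  by clear; case: (keeps_laps _ _).
have E (p : 'I_m.+1) : true -> (if laps n (insert_min p w) == n then 1 else 0) =
   (laps n w == n) * keeps_laps (nth true (sig n w)) p +
   (laps n w == n - 2) * ~~ keeps_laps (nth true (sig n w)) p.
  move=> _; rewrite laps_insert_min; [exact: bE|by rewrite sw|].
  by rewrite sw -ltnS ltn_ord.
rewrite (eq_bigr _ E) big_split /= -!big_distrr /= -lw -fE //.
  by rewrite -[in RHS]sc addnK.
by rewrite -sc leq_addl.
Qed.

End Words.

(** * Gaps between values of a polynomial with real critical points *)

(** At [i = 0] the quotient is a division by 0, hence 0: this primitive vanishes at 0. *)
Definition primitive_poly (R : fieldType) (p : {poly R}) : {poly R} :=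
  \poly_(i < (size p).+1) (p`_i.-1 / i%:R).

Lemma coef_primitive (R : fieldType) (p : {poly R}) i :
  (primitive_poly p)`_i = p`_i.-1 / i%:R.
Proof.
rewrite coef_poly; case: ltnP => // hi; rewrite nth_default ?mul0r //.
by case: i hi.
Qed.

Lemma deriv_primitive (R : numFieldType) (p : {poly R}) :
  (primitive_poly p)^`() = p.
Proof.
apply/polyP => i; rewrite coef_deriv coef_primitive /= -[LHS]mulr_natr.
by rewrite divfK // pnatr_eq0.
Qed.

Lemma deriv_eq0 (R : rcfType) (p : {poly R}) a b : p^`() = 0 -> p.[a] = p.[b].
Proof.
move=> p0; wlog ab : a b / a < b => [H|].
  by case: (ltgtP a b) => [/H//|/H//|->].
by have [c _] := poly_mvt p ab; rewrite p0 horner0 mul0r => /subr0_eq.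
Qed.

(** Rolle's theorem between consecutive roots; the strict path also records that the new roots lie
    to the right of [z]. *)
Lemma rolle_path (R : rcfType) (p : {poly R}) z s :
  path <%R z s -> all (root p) (z :: s) ->
  exists t, [/\ size t = size s, path <%R z t & all (root p^`()) t].
Proof.
elim: s z => [|y s IH] z /=; first by exists [::].
move=> /andP[zy ys] /and3P[rz ry rs].
have [|t [st pt rt]] := IH y ys; first by rewrite /= ry.
have [|c] := @poly_rolle _ z y p zy; first by rewrite (rootP rz) (rootP ry).
rewrite in_itv /= => /andP[zc cy] /rootP rc.
exists (c :: t); split => /=; rewrite ?st ?rc ?zc //=.
by case: t pt {st rt} => //= u t /andP[yu ->]; rewrite (lt_trans cy yu).
Qed.

Lemma size_monic_sub (R : nzRingType) (p q : {poly R}) n :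
  p \is monic -> q \is monic -> size p = n.+1 -> size q = n.+1 ->
  (size (p - q)%R <= n)%N.
Proof.
move=> /monicP mp /monicP mq sp sq; apply/leq_sizeP => j.
rewrite leq_eqVlt coefB => /orP[/eqP<-|nj]; last by rewrite !nth_default ?subrr ?sp ?sq.
by move: mp mq; rewrite /lead_coef sp sq /= => -> ->; rewrite subrr.
Qed.

Lemma prodr_const_seq (R : nzRingType) (I : Type) (s : seq I) (c : R) :
  \prod_(k <- s) c = c ^+ size s.
Proof. by rewrite big_const_seq count_predT iter_mulr_1. Qed.

Section Gaps.
Variables (R : rcfType) (m : nat) (cr : seq nat).
Implicit Types (x X : nat -> R).

(* x lists the marked points and cr the indices of the critical ones; pcrit is
   the polynomial of degree n = (size cr).+1 with these critical points. *)
Definition dcrit x : {poly R} := \prod_(k <- cr) ('X - (x k)%:P).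
Definition pcrit x : {poly R} := primitive_poly ((size cr).+1%:R *: dcrit x).
(** For increasing [x], this is the sign of [dcrit x] between the points [i] and [i.+1]: one factor
    -1 for each critical point further right. It makes the gaps positive. *)
Definition lap_sign (i : nat) : R := \prod_(k <- cr) (-1) ^+ (i < k).
Definition gap x (i : nat) : R :=
  lap_sign i * ((pcrit x).[x i.+1] - (pcrit x).[x i]).
Definition increasing x := forall i k, (i < k < m)%N -> x i < x k.

Hypothesis crm : all (gtn m) cr.
Hypothesis crS : sorted ltn cr.

Lemma lap_sign_sqr i : lap_sign i * lap_sign i = 1.
Proof. by rewrite -big_split big1 //= => k _; rewrite -expr2 sqrr_sign. Qed.

Lemma lap_signM i j : lap_sign i * (lap_sign i * j) = j.
Proof. by rewrite mulrA lap_sign_sqr mul1r. Qed.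

Lemma prod_sign_leq i :
  \prod_(k <- cr) (-1) ^+ (i <= k)%N = (-1) ^+ (i \in cr) * lap_sign i :> R.
Proof.
have := sorted_uniq ltn_trans ltnn crS.
rewrite /lap_sign; elim: (cr) => [|k s IH] /=.
  by rewrite !big_nil expr0 mulr1.
move=> /andP[ks us]; rewrite !big_cons IH // in_cons.
move: ks; have [<- ks|nk _] := eqVneq i k.
  by rewrite (negbTE ks) leqnn ltnn expr1 expr0 !mul1r mulN1r.
rewrite /= [in LHS]leq_eqVlt (negbTE nk) /=; ring.
Qed.

Lemma lap_signS i : lap_sign i = (-1) ^+ (i.+1 \in cr) * lap_sign i.+1.
Proof. exact: prod_sign_leq. Qed.

(** The inequalities are weak so that both ends of the [i]-th interval qualify, even when they are
    critical points. *)
Definition separates x (i : nat) (z : R) :=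
  {in cr, forall k, if (i < k)%N then z <= x k else x k <= z}.

Lemma sign_dcrit x i z : separates x i z ->
  lap_sign i * (dcrit x).[z] = \prod_(k <- cr) `|z - x k|.
Proof.
move=> sep; rewrite horner_prod -big_split /= !big_seq; apply: eq_bigr => k kc.
have := sep k kc; rewrite hornerXsubC; case: ifP => _ h /=.
  by rewrite expr1 mulN1r ler0_norm ?subr_le0.
by rewrite expr0 mul1r ger0_norm ?subr_ge0.
Qed.

Lemma deriv_pcrit x : (pcrit x)^`() = (size cr).+1%:R *: dcrit x.
Proof. exact: deriv_primitive. Qed.

Lemma pcrit_mvt x i a b : a < b -> separates x i a -> separates x i b ->
  exists c, [/\ a < c < b, separates x i c &
   lap_sign i * ((pcrit x).[b] - (pcrit x).[a]) =
     (size cr).+1%:R * (\prod_(k <- cr) `|c - x k|) * (b - a)].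
Proof.
move=> ab sa sb; have [c] := poly_mvt (pcrit x) ab.
rewrite in_itv /= => /andP[ac cb] e.
have sc : separates x i c.
  move=> k kc; move: (sa k kc) (sb k kc); case: ifP => _ h1 h2.
    by rewrite (le_trans (ltW cb)).
  by rewrite (le_trans h1 (ltW ac)).
exists c; split; rewrite ?ac ?cb //.
by rewrite e deriv_pcrit hornerZ -(sign_dcrit sc); ring.
Qed.

Lemma pcrit_lt x i a b : a < b -> separates x i a -> separates x i b ->
  0 < lap_sign i * ((pcrit x).[b] - (pcrit x).[a]).
Proof.
move=> ab sa sb; have [c [/andP[ac cb] sc ->]] := pcrit_mvt ab sa sb.
rewrite !mulr_gt0 ?ltr0Sn ?subr_gt0 //.
rewrite big_seq prodr_gt0 // => k kc; rewrite normr_gt0 subr_eq0.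
have := sa k kc; have := sb k kc; case: ifP => _ h1 h2.
  by rewrite lt_eqF // (lt_le_trans cb).
by rewrite gt_eqF // (le_lt_trans h2).
Qed.

Lemma separates_pts x i z : increasing x -> (i < m)%N -> x i <= z ->
  ((i.+1 < m)%N -> z <= x i.+1) -> separates x i z.
Proof.
move=> xi im iz zi k kc; have km : (k < m)%N by move/allP: crm => /(_ k kc).
case: ltnP => [ik|ki].
  apply: le_trans (zi (leq_ltn_trans ik km)) _.
  by move: ik; rewrite leq_eqVlt => /orP[/eqP->//|h]; rewrite ltW // xi // h.
apply: le_trans iz; move: ki; rewrite leq_eqVlt => /orP[/eqP->//|h].
by rewrite ltW // xi // h.
Qed.

Lemma gap_gt0 x i : increasing x -> (i.+1 < m)%N -> 0 < gap x i.
Proof.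
move=> xi im; have h : x i < x i.+1 by rewrite xi // ltnSn.
by apply: pcrit_lt => //; apply: separates_pts; rewrite ?(ltnW im) // ltW.
Qed.

Lemma size_dcrit x : size (dcrit x) = (size cr).+1.
Proof. by rewrite /dcrit size_prod_XsubC. Qed.

Lemma root_dcrit x z : root (dcrit x) z = (z \in map x cr).
Proof.
by rewrite /dcrit -(big_map x predT (fun a => 'X - a%:P)) root_prod_XsubC.
Qed.

Lemma monic_dcrit x : dcrit x \is monic.
Proof. exact: monic_prod_XsubC. Qed.

(** The signs [lap_sign i] and [lap_sign i.+1] are opposite because the point [i.+1] is critical.
    Multiplied by the latter, the polynomial decreases up to this point and increases after it. *)
Lemma crit_extremum x i z : increasing x -> (i.+1 < m)%N -> i.+1 \in cr ->
  x i <= z -> ((i.+2 < m)%N -> z <= x i.+2) ->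
  0 <= lap_sign i.+1 * ((pcrit x).[z] - (pcrit x).[x i.+1]).
Proof.
move=> xi im ic iz zi.
have h1 : x i < x i.+1 by rewrite xi // ltnSn.
have h2 : (i.+2 < m)%N -> x i.+1 < x i.+2 by move=> h; rewrite xi // ltnSn.
have [h|h|->] := ltgtP z (x i.+1); last by rewrite subrr mulr0.
- have := @pcrit_lt x i z (x i.+1) h; rewrite lap_signS ic expr1.
  move=> H; rewrite ltW // -opprB mulrN -mulNr -mulN1r; apply: H.
    by apply: separates_pts => // [|_]; rewrite ?(ltnW im) ?ltW.
  by apply: separates_pts => // [|]; rewrite ?(ltnW im) ?ltW.
- apply/ltW/pcrit_lt => //; apply: separates_pts => //; last exact: ltW.
  by move=> /h2/ltW.
Qed.

(* D below, the difference of the two polynomials with their values at the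
   (j + 1)-st points subtracted, has a root in [x j, x (j + 1)[ and one between
   x i and X i for each critical i > j; together with the common critical points
   of index at most j, Rolle's theorem yields too many roots of D'. *)
Lemma gap_lt_local x X j : increasing x -> increasing X -> (j.+1 < m)%N ->
  (forall i, (i <= j)%N -> x i = X i) ->
  (forall i k, (i < k < m)%N -> x i < X k /\ X i < x k) ->
  x j.+1 < X j.+1 ->
  (forall i, (j < i)%N -> (i.+1 < m)%N -> gap x i = gap X i) ->
  gap x j < gap X j.
Proof.
move=> xi Xi jm eqx int ltj eqg; rewrite ltNge; apply/negP => geg.
set f := pcrit x; set G := pcrit X.
pose D := (f - (f.[x j.+1])%:P) - (G - (G.[X j.+1])%:P).
have DE z : D.[z] = (f.[z] - f.[x j.+1]) - (G.[z] - G.[X j.+1]).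
  by rewrite /D !hornerE.
(* Beyond [j] the gaps agree, so the values agree once measured from the point [j.+1]. *)
have vals i : (j < i < m)%N -> f.[x i] - f.[x j.+1] = G.[X i] - G.[X j.+1].
  elim: i => // i IH /andP[]; rewrite ltnS leq_eqVlt => /orP[/eqP<- _|ji im].
    by rewrite !subrr.
  have := eqg i ji im; rewrite /gap => /(congr1 ( *%R (lap_sign i))).
  rewrite !lap_signM -/f -/G; have := IH; rewrite ji (ltnW im) => /(_ isT); lra.
(* Since [X j = x j < x j.+1 < X j.+1], the point [x j.+1] lies inside the [j]-th interval of [X],
   where [G] is strictly monotone. *)
have Dj1 : 0 < lap_sign j * D.[x j.+1].
  have Xjx : X j < x j.+1 by rewrite -eqx // xi // ltnSn.
  have XjX : X j < X j.+1 by rewrite Xi // ltnSn.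
  rewrite DE subrr sub0r opprB.
  by apply: pcrit_lt => //; apply: separates_pts; rewrite ?(ltnW jm) // => *; apply: ltW.
have Dj : lap_sign j * D.[x j] <= 0.
  rewrite DE [X in G.[X]]eqx //; move: geg; rewrite /gap -/f -/G; lra.
have Dsg : D.[x j] * D.[x j.+1] <= 0.
  rewrite -(lap_signM j (_ * _)) [_ * (_ * _)](_ : _ =
     (lap_sign j * D.[x j]) * (lap_sign j * D.[x j.+1])); last by ring.
  by rewrite pmulr_lle0.
have xjj : x j < x j.+1 by rewrite xi // ltnSn.
have [z0 z0i rz0] := @polyrcf.poly_ivt _ D _ _ (ltW xjj) Dsg.
move: z0i; rewrite in_itv /= => /andP[jz0 z0j].
have {}z0j : z0 < x j.+1.
  rewrite lt_neqAle z0j andbT; apply: contraTneq Dj1 => <-.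
  by move/rootP: rz0 => ->; rewrite mulr0 ltxx.
(* The minimum and the maximum occur because the order of [x i] and [X i] is unknown; 0 is a filler
   at the irrelevant indices. *)
have zf i : {z | (j < i < m)%N && (i \in cr) ->
    (Num.min (x i) (X i) <= z <= Num.max (x i) (X i)) && root D z}.
  case: (boolP ((j < i < m)%N && (i \in cr))) => [|_]; last by exists 0.
  move=> /andP[/andP[ji im] ic].
  have ei : i = i.-1.+1 by rewrite (ltn_predK ji).
  suff Dm : D.[Num.min (x i) (X i)] * D.[Num.max (x i) (X i)] <= 0.
    have [|z zi rz] := @polyrcf.poly_ivt _ D _ _ _ Dm.
      by rewrite ge_min le_max lexx.
    by exists z => _; rewrite rz andbT; move: zi; rewrite in_itv.
  have -> : D.[Num.min (x i) (X i)] * D.[Num.max (x i) (X i)] = D.[x i] * D.[X i].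
    by case: (ltP (x i) (X i)) => // _; rewrite mulrC.
  have v : f.[x i] - f.[x j.+1] = G.[X i] - G.[X j.+1] by apply: vals; rewrite ji.
  rewrite -(lap_signM i (_ * _)).
  (* By [vals], [D] is a difference of values of [G] at [x i] and of values of [f] at [X i]. Each
     polynomial has an extremum of the same kind at its own [i]-th point, so these two numbers have
     weakly opposite signs. *)
  have -> : lap_sign i * (lap_sign i * (D.[x i] * D.[X i])) =
     - (lap_sign i * (G.[x i] - G.[X i])) * (lap_sign i * (f.[X i] - f.[x i])).
    have -> : D.[x i] = - (G.[x i] - G.[X i]) by rewrite DE v; ring.
    have -> : D.[X i] = f.[X i] - f.[x i] by rewrite DE -v; ring.
    by ring.
  rewrite mulNr oppr_le0 mulr_ge0 //.
    rewrite ei; apply: crit_extremum; rewrite -?ei //.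
      by rewrite ltW //; apply: (int _ _ _).2; rewrite {2}ei ltnSn.
    by move=> im2; rewrite ltW //; apply: (int _ _ _).1; rewrite ltnSn.
  rewrite ei; apply: crit_extremum; rewrite -?ei //.
    by rewrite ltW //; apply: (int _ _ _).1; rewrite {2}ei ltnSn.
  by move=> im2; rewrite ltW //; apply: (int _ _ _).2; rewrite ltnSn.
have zfP i : (j < i)%N -> i \in cr ->
    [/\ Num.min (x i) (X i) <= sval (zf i), sval (zf i) <= Num.max (x i) (X i) &
        root D (sval (zf i))].
  move=> ji ic; have im : (i < m)%N by move/allP: crm => /(_ i ic).
  by case: (zf i) => z /=; rewrite ji im ic => /(_ isT)/andP[/andP[]].
pose s := [seq k <- cr | (j < k)%N].
have sP k : k \in s -> (j < k)%N /\ k \in cr by rewrite mem_filter => /andP[].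
have sS : sorted <%R (z0 :: [seq sval (zf i) | i <- s]).
  rewrite /= path_min_sorted; last first.
    apply/allP => _ /mapP[i /sP[ji ic] ->].
    have [+ _ _] := zfP i ji ic; apply: lt_le_trans; apply: (lt_le_trans z0j).
    have im : (i < m)%N by move/allP: crm => /(_ i ic).
    rewrite le_min; apply/andP; split.
      by move: ji; rewrite leq_eqVlt => /orP[/eqP->//|h]; rewrite ltW // xi // h.
    apply: le_trans (ltW ltj) _.
    by move: ji; rewrite leq_eqVlt => /orP[/eqP->//|h]; rewrite ltW // Xi // h.
  apply: (@homo_sorted_in _ _ (mem s) _ ltn <%R); last 2 first.
  - exact/allP.
  - by apply: sorted_filter => //; apply: ltn_trans.
  move=> i k /sP[ji ic] /sP[jk kc] ik /=.
  have [_ h1 _] := zfP i ji ic; have [h2 _ _] := zfP k jk kc.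
  apply: le_lt_trans h1 _; apply: lt_le_trans h2.
  have km : (k < m)%N by move/allP: crm => /(_ k kc).
  have ikm : (i < k < m)%N by rewrite km andbT.
  rewrite lt_min !gt_max !xi ?Xi //=.
  by have [-> ->] := int _ _ ikm.
have [|t [szt pt rt]] := @rolle_path _ D z0 _ sS.
  rewrite /= rz0; apply/allP => _ /mapP[i /sP[ji ic] ->].
  by have [] := zfP i ji ic.
have D'E : D^`() = (size cr).+1%:R *: (dcrit x - dcrit X).
  by rewrite /D !derivB !derivC !subr0 !deriv_pcrit -scalerBr.
pose u := [seq k <- cr | ~~ (j < k)%N].
have D'0 : D^`() = 0.
  apply: (@poly_ltsp_roots _ _ ([seq x k | k <- u] ++ t)).
  - rewrite D'E size_cat szt !size_map !size_filter addnC count_predC.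
    rewrite size_scale ?pnatr_eq0 //.
    by apply: size_monic_sub; rewrite ?monic_dcrit ?size_dcrit.
  - rewrite cat_uniq; apply/and3P; split.
    + rewrite map_inj_in_uniq ?filter_uniq ?(sorted_uniq ltn_trans ltnn crS) //.
      have um k : k \in u -> (k < m)%N.
        by rewrite mem_filter => /andP[_ kc]; move/allP: crm => /(_ k kc).
      move=> k l /um km /um lm e.
      case: (ltngtP k l) => // h; [have := xi k l | have := xi l k].
        by rewrite h lm e ltxx => /(_ isT).
      by rewrite h km e ltxx => /(_ isT).
    (* The common critical points are at most [x j <= z0], while the roots from Rolle's theorem are
       greater than [z0]. *)
    + apply/hasPn => y yt; apply/mapP => -[k]; rewrite mem_filter -leqNgt => /andP[kj kc] ey.
      have /allP ht := order_path_min lt_trans pt.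
      have := ht y yt; rewrite ltNge ey => /negP; apply; apply: le_trans jz0.
      by move: kj; rewrite leq_eqVlt => /orP[/eqP->//|h]; rewrite ltW // xi // h (ltnW jm).
    + by move: (path_sorted pt); exact: (sorted_uniq lt_trans ltxx).
  - rewrite all_cat rt andbT; apply/allP => y /mapP[k].
    rewrite mem_filter -leqNgt => /andP[kj kc] {y}->.
    have rd y : y k = x k -> (dcrit y).[x k] = 0.
      by move=> yk; apply/rootP; rewrite root_dcrit -yk map_f.
    apply/rootP; rewrite D'E hornerZ !hornerE !rd ?subrr ?mulr0 //.
    by rewrite eqx.
move: Dj1; rewrite (deriv_eq0 _ z0 D'0); move/rootP: rz0 => ->.
by rewrite mulr0 ltxx.
Qed.

(** On the middle third of the interval every critical point is at distance at least one third of
    the spacing, which bounds the derivative from below. The outer thirds contribute positively. *)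
Lemma gap_lower x i : increasing x -> (i.+1 < m)%N ->
  ((x i.+1 - x i) / 3) ^+ (size cr).+1 <= gap x i.
Proof.
move=> xi im; set s := (_ / 3).
have h : x i < x i.+1 by rewrite xi // ltnSn.
have s0 : 0 < s by rewrite divr_gt0 // subr_gt0.
have es : x i.+1 = x i + s *+ 3.
  by rewrite /s -mulr_natr divfK ?pnatr_eq0 // addrC subrK.
have sep z : x i <= z -> z <= x i.+1 -> separates x i z.
  by move=> iz zi; apply: separates_pts => //; apply: ltnW.
have [sa sb] : separates x i (x i + s) /\ separates x i (x i + s *+ 2).
  by split; apply: sep; rewrite ?es; lra.
have [sc sd] : separates x i (x i) /\ separates x i (x i.+1).
  by split; apply: sep => //; apply: ltW.
have l1 : x i < x i + s by lra.
have l2 : x i + s < x i + s *+ 2 by lra.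
have l3 : x i + s *+ 2 < x i.+1 by rewrite es; lra.
have := pcrit_lt l1 sc sa; have := pcrit_lt l3 sb sd.
have [c [/andP[ac cb] _]] := pcrit_mvt l2 sa sb.
rewrite /gap => e g1 g2.
apply: (@le_trans _ _ (lap_sign i * ((pcrit x).[x i + s *+ 2] - (pcrit x).[x i + s]))).
  rewrite e; have -> : x i + s *+ 2 - (x i + s) = s by ring.
  rewrite exprSr ler_pM2r //.
  apply: (@le_trans _ _ (\prod_(k <- cr) `|c - x k|)); last first.
    rewrite ler_peMl ?ler1n ?prodr_ge0 //.
  rewrite -prodr_const_seq big_seq [leRHS]big_seq ler_prod // => k kc.
  rewrite (ltW s0) /=.
  have km : (k < m)%N by move/allP: crm => /(_ k kc).
  rewrite ler_normr; case: (leqP k i) => ki; apply/orP; [left|right].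
    have : x k <= x i.
      move: ki; rewrite leq_eqVlt => /orP[/eqP->//|hk].
      by rewrite ltW // xi // hk (ltnW im).
    by move: ac; lra.
  have : x i.+1 <= x k.
    move: ki; rewrite leq_eqVlt => /orP[/eqP->//|hk].
    by rewrite ltW // xi // hk.
  by move: cb; rewrite es; lra.
by move: g1 g2; rewrite !mulrBr; lra.
Qed.

(** By the mean value theorem, a gap tends to 0 with its spacing as long as the whole configuration
    stays bounded. *)
Lemma gap_upper x i B : increasing x -> (i.+1 < m)%N ->
  (forall j k, (j < k < m)%N -> x k - x j <= B) ->
  gap x i <= (size cr).+1%:R * B ^+ size cr * (x i.+1 - x i).
Proof.
move=> xi im xB; have h : x i < x i.+1 by rewrite xi // ltnSn.
have sep z : x i <= z -> z <= x i.+1 -> separates x i z.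
  by move=> iz zi; apply: separates_pts => //; apply: ltnW.
have [||c [/andP[ac cb] sc]] := @pcrit_mvt x i (x i) (x i.+1) h.
- by apply: sep => //; apply: ltW.
- by apply: sep => //; apply: ltW.
rewrite /gap => ->; rewrite ler_pM2r ?subr_gt0 // ler_pM2l ?ltr0Sn //.
rewrite -prodr_const_seq big_seq [leRHS]big_seq ler_prod // => k kc.
have km : (k < m)%N by move/allP: crm => /(_ k kc).
rewrite normr_ge0 ler_norml /=; apply/andP; split.
- have : x k - x i <= B.
    case: (ltngtP k i) => [ki|ki|->]; last 1 first.
    + by have := xB i i.+1; rewrite ltnSn => /(_ im); move: h; rewrite subrr; lra.
    + by have := xB i i.+1; rewrite ltnSn => /(_ im);
        have := xi k i; rewrite ki (ltnW im) => /(_ isT); move: h; lra.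
    + by apply: xB; rewrite ki.
  by move: ac; lra.
- have : x i.+1 - x k <= B.
    case: (ltngtP k i.+1) => [ki|ki|->]; last 1 first.
    + by have := xB i i.+1; rewrite ltnSn => /(_ im); move: h; rewrite subrr; lra.
    + by apply: xB; rewrite ki.
    + by have := xB i i.+1; rewrite ltnSn => /(_ im);
        have := xi i.+1 k; rewrite ki => /(_ km); move: h; lra.
  by move: cb; lra.
Qed.

(** Since [pcrit] is normalised to vanish at 0, it commutes with translations only up to a constant;
    differences of values are invariant. *)
Lemma pcrit_shift x a y z :
  (pcrit (fun k => x k + a)).[y + a] - (pcrit (fun k => x k + a)).[z + a] =
  (pcrit x).[y] - (pcrit x).[z].
Proof.
set q := pcrit _; pose D := q \Po ('X + a%:P) - pcrit x.
have D0 : D^`() = 0.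
  rewrite derivB deriv_comp derivD derivX derivC addr0 mulr1 !deriv_pcrit.
  rewrite linearZ /= -scalerBr /dcrit rmorph_prod /=.
  rewrite (eq_bigr (fun k => 'X - (x k)%:P)) ?subrr ?scaler0 // => k _.
  by rewrite comp_polyB comp_polyX comp_polyC polyCD; ring.
have := deriv_eq0 y z D0; rewrite /D !hornerE !horner_comp !hornerE; lra.
Qed.

Lemma gap_shift x a i : gap (fun k => x k + a) i = gap x i.
Proof. by rewrite /gap pcrit_shift. Qed.

End Gaps.

(** * Recovering the points from the gaps *)

Section ContinuousFamilies.
Variables (R : realType) (U : topologicalType).
Implicit Types f g : U -> R.

Lemma contD f g : continuous f -> continuous g -> continuous (fun u => f u + g u).
Proof. by move=> cf cg u; apply: cvgD; [exact: cf|exact: cg]. Qed.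

Lemma contN f : continuous f -> continuous (fun u => - f u).
Proof. by move=> cf u; apply: cvgN; exact: cf. Qed.

Lemma contB f g : continuous f -> continuous g -> continuous (fun u => f u - g u).
Proof. by move=> cf cg; apply: contD => //; apply: contN. Qed.

Lemma contM f g : continuous f -> continuous g -> continuous (fun u => f u * g u).
Proof. by move=> cf cg u; apply: cvgM; [exact: cf|exact: cg]. Qed.

Lemma cont_cst (c : R) : continuous (fun _ : U => c).
Proof. exact: cst_continuous. Qed.

Lemma cont_sum (I : Type) (r : seq I) (P : pred I) (F : I -> U -> R) :
  (forall i, P i -> continuous (F i)) ->
  continuous (fun u => \sum_(i <- r | P i) F i u).
Proof. by move=> cF; apply: continuous_big => //; exact: add_continuous. Qed.

Lemma cont_exp f n : continuous f -> continuous (fun u => f u ^+ n).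
Proof.
move=> cf; elim: n => [|n IH].
  rewrite (_ : (fun u => _) = fun=> 1); first exact: cont_cst.
  by apply/funext => u; rewrite expr0.
rewrite (_ : (fun u => _) = fun u => f u * f u ^+ n); first exact: contM.
by apply/funext => u; rewrite exprS.
Qed.

Definition cont_poly (P : U -> {poly R}) := forall i, continuous (fun u => (P u)`_i).

Lemma cont_polyM P Q : cont_poly P -> cont_poly Q -> cont_poly (fun u => P u * Q u).
Proof.
move=> cP cQ i; under [X in continuous X]funext => u do rewrite coefM.
by apply: cont_sum => j _; apply: contM.
Qed.

Lemma cont_polyXsubC f : continuous f -> cont_poly (fun u => 'X - (f u)%:P).
Proof.
move=> cf i; under [X in continuous X]funext => u do rewrite coefB coefX coefC.
apply: contB; first exact: cont_cst.
by case: eqP => _ //; exact: cont_cst.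
Qed.

Lemma cont_horner P f N : cont_poly P -> (forall u, (size (P u) <= N)%N) ->
  continuous f -> continuous (fun u => (P u).[f u]).
Proof.
move=> cP sP cf.
rewrite (_ : (fun u => _) = fun u => \sum_(i < N) (P u)`_i * f u ^+ i); last first.
  by apply/funext => u; rewrite (horner_coef_wide _ (sP u)).
by apply: cont_sum => i _; apply: contM => //; apply: cont_exp.
Qed.

Variables (m : nat) (cr : seq nat).

Lemma cont_dcrit (x : nat -> U -> R) : (forall i, continuous (x i)) ->
  cont_poly (fun u => dcrit cr (x^~ u)).
Proof.
move=> cx; rewrite /dcrit; elim: cr => [|k s IH] i.
  under [X in continuous X]funext => u do rewrite big_nil.
  exact: cont_cst.
under [X in continuous X]funext => u do rewrite big_cons.
by apply: cont_polyM => //; apply: cont_polyXsubC.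
Qed.

Lemma cont_pcrit (x : nat -> U -> R) : (forall i, continuous (x i)) ->
  cont_poly (fun u => pcrit cr (x^~ u)).
Proof.
move=> cx i; under [X in continuous X]funext => u do rewrite coef_primitive coefZ.
apply: contM; last exact: cont_cst.
by apply: contM; [exact: cont_cst|exact: cont_dcrit].
Qed.

Lemma size_pcrit (x : nat -> R) : (size (pcrit cr x) <= (size cr).+2)%N.
Proof.
apply: leq_trans (size_poly _ _) _.
by rewrite ltnS (leq_trans (size_scale_leq _ _)) // size_dcrit.
Qed.

Lemma cont_pcrit_horner (x : nat -> U -> R) f : (forall i, continuous (x i)) ->
  continuous f -> continuous (fun u => (pcrit cr (x^~ u)).[f u]).
Proof.
move=> cx cf; apply: cont_horner cf => [|u]; first exact: cont_pcrit.
exact: size_pcrit.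
Qed.

Lemma cont_gap (x : nat -> U -> R) i : (forall i, continuous (x i)) ->
  continuous (fun u => gap cr (x^~ u) i).
Proof.
move=> cx; apply: contM; first exact: cont_cst.
by apply: contB; apply: cont_pcrit_horner.
Qed.

(** The intermediate value theorem gives the solution and monotonicity makes it unique. For
    continuity at [u0], the values of [phi] at [y u0 - e] and [y u0 + e] still bracket [h u] for [u]
    near [u0]. *)
Lemma implicit_continuous (phi : U * R -> R) (h : U -> R) :
  continuous phi -> continuous h ->
  (forall u a b, a < b -> phi (u, a) < phi (u, b)) ->
  (forall u, exists a, phi (u, a) < h u) ->
  (forall u, exists b, h u < phi (u, b)) ->
  exists2 y : U -> R, continuous y & forall u, phi (u, y u) = h u.
Proof.
move=> cphi ch inc lo hi.
have cphiu u : continuous (fun a => phi (u, a)).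
  move=> a; apply: (@continuous_comp _ _ _ (fun a => (u, a)) phi); last exact: cphi.
  exact: (@cvg_pair _ _ _ (nbhs a) (nbhs u) (nbhs a) _ _ _ (fun=> u) id (cvg_cst u) cvg_id).
have cphia a : continuous (fun u => phi (u, a)).
  move=> u; apply: (@continuous_comp _ _ _ (fun u => (u, a)) phi); last exact: cphi.
  exact: (@cvg_pair _ _ _ (nbhs u) (nbhs u) (nbhs a) _ _ _ id (fun=> a) cvg_id (cvg_cst a)).
have ex u : exists y, phi (u, y) = h u.
  have [a la] := lo u; have [b hb] := hi u.
  have ab : a < b.
    rewrite ltNge; apply/negP; rewrite le_eqVlt => /orP[/eqP e|/(inc u)].
      by move: (lt_trans la hb); rewrite e ltxx.
    by move=> /lt_trans /(_ la) /lt_trans /(_ hb); rewrite ltxx.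
  have [||c _ e] := @IVT R (fun y => phi (u, y)) a b (h u) (ltW ab).
  - exact: continuous_subspaceT.
  - by rewrite ge_min le_max (ltW la) (ltW hb) orbT.
  by exists c.
have [y yP] := choice ex; exists y => // u0.
apply/cvgrPdist_lt => e e0.
have l1 : phi (u0, y u0 - e) < h u0 by rewrite -yP inc // ltrBlDr ltrDl.
have l2 : h u0 < phi (u0, y u0 + e) by rewrite -yP inc // ltrDl.
have c1 : continuous (fun u => h u - phi (u, y u0 - e)) by apply: contB.
have c2 : continuous (fun u => phi (u, y u0 + e) - h u) by apply: contB.
near=> u.
have p1 : 0 < h u - phi (u, y u0 - e).
  by near: u; apply: (cvgr_gt _ (c1 u0)); rewrite subr_gt0.
have p2 : 0 < phi (u, y u0 + e) - h u.
  by near: u; apply: (cvgr_gt _ (c2 u0)); rewrite subr_gt0.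
have q1 : y u0 - e < y u.
  rewrite ltNge; apply/negP; rewrite le_eqVlt => /orP[/eqP E|/(inc u)].
    by move: p1; rewrite -E yP subrr ltxx.
  by rewrite yP; move: p1; rewrite subr_gt0 => /lt_trans h1 /h1; rewrite ltxx.
have q2 : y u < y u0 + e.
  rewrite ltNge; apply/negP; rewrite le_eqVlt => /orP[/eqP E|/(inc u)].
    by move: p2; rewrite E yP subrr ltxx.
  by rewrite yP; move: p2; rewrite subr_gt0 => /lt_trans h1 /h1; rewrite ltxx.
by rewrite ltr_norml; apply/andP; split; lra.
Unshelve. all: by end_near. Qed.

End ContinuousFamilies.

(** The supremum of the points up to which [f] stays above [f a] cannot be less than [b]. This is
    what allows comparing only nearby configurations in [gap_lt_local]. *)
Lemma locally_increasing (R : realType) (f : R -> R) :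
  (forall y, exists2 d, 0 < d & forall a b, `|a - y| < d -> `|b - y| < d ->
     a < b -> f a < f b) ->
  forall a b, a < b -> f a < f b.
Proof.
move=> lf a b ab.
pose S := [set t | a <= t <= b /\ forall s, a < s <= t -> f a < f s].
have Sa : S a by split; [rewrite lexx ltW|move=> s /andP[/lt_le_trans h /h]; rewrite ltxx].
have uS : ubound S b by move=> t [/andP[]].
have hS : has_sup S by split; [exists a|exists b].
have at0 : a <= sup S by apply: ub_le_sup => //; exists b.
have t0b : sup S <= b by apply: ge_sup => //; exists a.
have [d d0 dP] := lf (sup S).
have [t2 St2 t2l] := sup_adherent d0 hS.
have t2u : t2 <= sup S by apply: ub_le_sup => //; exists b.
have ext s : t2 < s -> s < sup S + d -> f a < f s.
  move=> ts sd; have ft : f t2 < f s.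
    by apply: dP => //; rewrite ltr_norml; lra.
  move: St2 => [/andP[]]; rewrite le_eqVlt => /orP[/eqP-> //|at2] _ h.
  by apply: lt_trans ft; apply: h; rewrite at2 lexx.
have [e|] := eqVneq (sup S) b.
  have [e2|n2] := eqVneq t2 b.
    by have [_ h] := St2; apply: h; rewrite ab e2 lexx.
  by apply: ext; rewrite -?e ?ltrDl // lt_neqAle t2u e n2.
move=> n0; have {n0 t0b}t0b : sup S < b by rewrite lt_neqAle n0.
(* This will be a point of [S] beyond its supremum. *)
pose s := Num.min b (sup S + d / 2).
have st : sup S < s by rewrite lt_min t0b ltrDl divr_gt0.
have Ss : S s.
  split; first by rewrite ge_min lexx (le_trans at0) // ltW.
  move=> r /andP[ar rs]; case: (leP r t2) => rt.
    by have [_ h] := St2; apply: h; rewrite ar.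
  apply: ext => //; apply: le_lt_trans rs _.
  by rewrite gt_min ltrD2l gtr_pMr // invf_lt1 ?ltr1n // orbT.
have : s <= sup S by apply: ub_le_sup => //; exists b.
by rewrite leNgt st.
Qed.

Definition positions (R : nmodType) (s : nat -> R) (i : nat) : R :=
  \sum_(k < i) s k.

Lemma positionsS (R : nmodType) (s : nat -> R) i :
  positions s i.+1 = positions s i + s i.
Proof. by rewrite /positions big_ord_recr. Qed.

Lemma eq_positions (R : nmodType) (s s' : nat -> R) i :
  (forall k, (k < i)%N -> s k = s' k) -> positions s i = positions s' i.
Proof. by move=> e; apply: eq_bigr => k _; apply: e. Qed.

Lemma positions_lt (R : realType) (s : nat -> R) i k :
  (forall i, 0 < s i) -> (i < k)%N -> positions s i < positions s k.
Proof.
move=> s0; elim: k => // k IH; rewrite ltnS leq_eqVlt positionsS.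
by move=> /orP[/eqP->|/IH h]; rewrite ?ltrDl // (lt_trans h) // ltrDl.
Qed.

Lemma increasing_positions (R : realType) m (s : nat -> R) :
  (forall i, 0 < s i) -> increasing m (positions s).
Proof. by move=> s0 i k /andP[ik _]; apply: positions_lt. Qed.

Section Solve.
Variables (R : realType) (m : nat) (cr : seq nat).
Hypothesis crm : all (gtn m) cr.
Hypothesis crS : sorted ltn cr.

Lemma eq_gap (x x' : nat -> R) i : (i.+1 < m)%N ->
  (forall k, (k < m)%N -> x k = x' k) -> gap cr x i = gap cr x' i.
Proof.
move=> im e; rewrite /gap !e ?(ltnW im) //.
suff -> : pcrit cr x = pcrit cr x' by [].
rewrite /pcrit /dcrit; congr (primitive_poly (_ *: _)).
rewrite !big_seq; apply: eq_bigr => k kc.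
by rewrite e //; move/allP: crm => /(_ k kc).
Qed.

Lemma eq_gap_positions (s s' : nat -> R) i : (i.+1 < m)%N ->
  (forall k, (k.+1 < m)%N -> s k = s' k) ->
  gap cr (positions s) i = gap cr (positions s') i.
Proof.
move=> im e; apply: eq_gap => // k km; apply: eq_positions => l lk; apply: e.
exact: leq_ltn_trans km.
Qed.

Lemma cont_positions (U : topologicalType) (s : nat -> U -> R) i :
  (forall i, continuous (s i)) -> continuous (fun u => positions (s^~ u) i).
Proof. by move=> cs; apply: cont_sum => k _; apply: cs. Qed.

Lemma gap_path_increasing j (s : nat -> R -> R) : (j.+1 < m)%N ->
  (forall i, continuous (s i)) -> (forall i y, 0 < s i y) ->
  (forall i a b, (i < j)%N -> s i a = s i b) ->
  (forall a b, a < b -> s j a < s j b) ->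
  (forall i a b, (j < i)%N -> (i.+1 < m)%N ->
     gap cr (positions (s^~ a)) i = gap cr (positions (s^~ b)) i) ->
  forall a b, a < b -> gap cr (positions (s^~ a)) j < gap cr (positions (s^~ b)) j.
Proof.
move=> jm cs s0 sj sjj sg; apply: locally_increasing => y0.
pose x i y := positions (s^~ y) i.
have cx i : continuous (x i) by apply: cont_positions.
pose mid i := (x i y0 + x i.+1 y0) / 2.
have xm i : x i y0 < mid i < x i.+1 y0.
  have : x i y0 < x i.+1 y0 by apply: positions_lt.
  by rewrite /mid; lra.
have : \forall y \near y0, forall i : 'I_m, x i y < mid i < x i.+1 y.
  apply: (@filter_forall R 'I_m (fun i y => x i y < mid i < x i.+1 y) (nbhs y0)
            (nbhs_filter y0)) => i.
  have /andP[h1 h2] := xm i.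
  near=> y; apply/andP; split; near: y.
    exact: (cvgr_lt _ (cx i y0)).
  exact: (cvgr_gt _ (cx i.+1 y0)).
move=> /nbhs_ballP[d /= d0 dP]; exists d => // a b ad bd ab.
have {}ad : forall i : 'I_m, x i a < mid i < x i.+1 a.
  by apply: dP; rewrite /ball /= distrC.
have {}bd : forall i : 'I_m, x i b < mid i < x i.+1 b.
  by apply: dP; rewrite /ball /= distrC.
apply: (gap_lt_local crm crS) => //.
- by apply: increasing_positions.
- by apply: increasing_positions.
- by move=> i ij; apply: eq_positions => k ki; apply: sj; apply: leq_trans ij.
- move=> i k /andP[ik km].
  have im : (i < m)%N by apply: ltn_trans km.
  have /andP[a1 a2] := ad (Ordinal im); have /andP[b1 b2] := bd (Ordinal im).
  have le c : x i.+1 c <= x k c.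
    move: ik; rewrite leq_eqVlt => /orP[/eqP->//|ik].
    by apply/ltW/positions_lt.
  split; first by apply: lt_le_trans (le b); apply: lt_trans b2.
  by apply: lt_le_trans (le a); apply: lt_trans a2.
- rewrite !positionsS.
  rewrite (@eq_positions _ (s^~ a) (s^~ b)) ?ltrD2l ?sjj //.
  by move=> k kj; apply: sj.
- by move=> i ji im; apply: sg.
Unshelve. all: by end_near. Qed.

(** Either the spacing is at most 3, or a third of it exceeds 1 and is at most its own power, which
    [gap_lower] bounds by the gap. A bound linear in the gap avoids extracting roots. *)
Lemma spacing_le (s : nat -> R) i : (forall i, 0 < s i) -> (i.+1 < m)%N ->
  s i <= 3 * (1 + gap cr (positions s) i).
Proof.
move=> s0 im; have := gap_lower crm (increasing_positions s0) im.
rewrite positionsS [positions s i + _]addrC addrK => h.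
set g := gap _ _ _ in h *; have g0 : 0 < g.
  by apply: (gap_gt0 crm) => //; apply: increasing_positions.
have [|l1] := leP (s i) 3; first by move: g0; lra.
have : s i / 3 <= (s i / 3) ^+ (size cr).+1.
  by rewrite ler_eXnr // ler_pdivlMr // mul1r ltW.
by move: h g0; lra.
Qed.

Lemma gap_le_spacing (s : nat -> R) j B : (forall i, 0 < s i) -> (j.+1 < m)%N ->
  (forall i, (i.+1 < m)%N -> s i <= B i) ->
  gap cr (positions s) j <=
    (size cr).+1%:R * (\sum_(i < m.-1) B i) ^+ size cr * s j.
Proof.
move=> s0 jm sB.
have := @gap_upper R m cr crm (positions s) j (\sum_(i < m.-1) B i)
          (increasing_positions s0) jm.
rewrite positionsS [positions s j + _]addrC addrK; apply => i k /andP[ik km].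
have m0 : (0 < m)%N by apply: leq_ltn_trans km.
have B0 l : (l.+1 < m)%N -> 0 <= B l by move=> /sB; apply: le_trans; apply: ltW.
apply: (@le_trans _ _ (positions s m.-1)).
  have : positions s k <= positions s m.-1.
    have : (k <= m.-1)%N by rewrite -ltnS prednK.
    by rewrite leq_eqVlt => /orP[/eqP->//|h]; apply/ltW/positions_lt.
  suff : 0 <= positions s i by lra.
  by apply: sumr_ge0 => l _; apply: ltW.
by apply: ler_sum => l _; apply: sB; have := ltn_ord l; lia.
Qed.

(* Spacings are prescribed before j and gaps from j on; j = 0 inverts the map
   from spacings to gaps. The induction step from j + 1 to j replaces U by
   U * R, the new parameter being the logarithm of the j-th spacing. *)
Lemma solve_spacings d j : (j + d).+1 = m ->
  (forall (U : topologicalType) (h : nat -> U -> R),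
    (forall i, continuous (h i)) -> (forall i u, 0 < h i u) ->
    exists s : nat -> U -> R,
      [/\ forall i, continuous (s i), forall i u, 0 < s i u,
          forall i u, (i < j)%N -> s i u = h i u &
          forall i u, (j <= i)%N -> (i.+1 < m)%N ->
            gap cr (positions (s^~ u)) i = h i u]) /\
  (forall s s' : nat -> R, (forall i, 0 < s i) -> (forall i, 0 < s' i) ->
    (forall i, (i < j)%N -> s i = s' i) ->
    (forall i, (j <= i)%N -> (i.+1 < m)%N ->
      gap cr (positions s) i = gap cr (positions s') i) ->
    forall i, (i.+1 < m)%N -> s i = s' i).
Proof.
elim: d j => [|d IH] j jd.
  rewrite addn0 in jd; split=> [U h ch h0|s s' _ _ e _ i]; last first.
    by rewrite -jd ltnS; apply: e.
  exists h; split => // i u ji; rewrite -jd ltnS => ij.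
  by move: (leq_ltn_trans ji ij); rewrite ltnn.
have [|ex un] := IH j.+1; first by rewrite addSnnS.
have jm : (j.+1 < m)%N by rewrite -jd ltnS addnS ltnS leq_addr.
split=> [U h ch h0|s s' s0 s'0 e eg].
  pose hh i (p : U * R) := if i == j then expR p.2 else h i p.1.
  have chh i : continuous (hh i).
    rewrite /hh; case: eqP => _ p.
      by apply: continuous_comp; [exact: cvg_snd|exact: continuous_expR].
    by apply: continuous_comp; [exact: cvg_fst|exact: ch].
  have hh0 i p : 0 < hh i p by rewrite /hh; case: eqP => _; rewrite ?expR_gt0.
  have [s [cs s0 sh sg]] := ex _ hh chh hh0.
  have sj u y : s j (u, y) = expR y by rewrite sh // /hh eqxx.
  have shi i u y : (i < j)%N -> s i (u, y) = h i u.
    by move=> ij; rewrite sh ?ltnS ?(ltnW ij) // /hh ltn_eqF.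
  have sgi i u y : (j < i)%N -> (i.+1 < m)%N ->
      gap cr (positions (s^~ (u, y))) i = h i u.
    by move=> ji im; rewrite sg // /hh gtn_eqF.
  pose phi p := gap cr (positions (s^~ p)) j.
  have cphi : continuous phi.
    apply: (@cont_gap R _ cr (fun i p => positions (s^~ p) i)) => i.
    exact: cont_positions.
  have inc u a b : a < b -> phi (u, a) < phi (u, b).
    apply: (@gap_path_increasing j (fun i y => s i (u, y))) => //.
    - move=> i y; apply: (@continuous_comp _ _ _ (fun a => (u, a)) (s i)).
        exact: (@cvg_pair _ _ _ (nbhs y) (nbhs u) (nbhs y) _ _ _ (fun=> u) id
                  (cvg_cst u) cvg_id).
      exact: cs.
    - by move=> i a' b' ij; rewrite !shi.
    - by move=> a' b' ab; rewrite !sj ltr_expR.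
    - by move=> i a' b' ji im; rewrite !sgi.
  have [||y cy yP] := implicit_continuous cphi (ch j) inc.
  - move=> u.
    (* Small [j]-th spacing [e]: [B] bounds the prescribed spacings on the left, the spacings on the
       right by [spacing_le], and [e] itself, which is at most 1. Hence the [j]-th gap is at most
       [C * e], and [e] is chosen to make this less than [h j u]. *)
    pose B i := 3 * (1 + h i u) + h i u + 1.
    have h0u i : 0 < h i u by [].
    have B0 i : 0 <= B i by have := h0u i; rewrite /B; lra.
    pose C : R := (size cr).+1%:R * (\sum_(i < m.-1) B i) ^+ size cr.
    have C0 : 0 <= C by rewrite mulr_ge0 ?exprn_ge0 ?sumr_ge0.
    pose e := Num.min 1 (h j u / (C + 1)).
    have e0 : 0 < e by rewrite lt_min ltr01 divr_gt0 // ltr_wpDl.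
    have e1 : e <= 1 by rewrite ge_min lexx.
    exists (ln e).
    have : phi (u, ln e) <= C * s j (u, ln e).
      apply: (@gap_le_spacing (s^~ (u, ln e)) j B) => // i im.
      case: (ltngtP i j) => ij.
      + by rewrite shi // /B; have := h0u i; lra.
      + have := @spacing_le (s^~ (u, ln e)) i (fun i => s0 i _) im.
        by rewrite sgi // /B; have := h0u i; lra.
      + by rewrite ij sj lnK ?posrE // /B; have := h0u j; lra.
    rewrite sj lnK ?posrE // => /le_lt_trans; apply.
    apply: (@le_lt_trans _ _ (C * (h j u / (C + 1)))).
      by rewrite ler_wpM2l // ge_min lexx orbT.
    rewrite mulrA ltr_pdivrMr ?ltr_wpDl // [ltLHS]mulrC ltr_pM2l // ltrDl //.
  (* A third of this spacing is [1 + h j u], so by [gap_lower] the gap is at least a positive power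
     of [1 + h j u], which exceeds [h j u]. *)
  - move=> u; exists (ln (3 * (1 + h j u))).
    have h0u : 0 < h j u by [].
    have p3 : 0 < 3 * (1 + h j u) by lra.
    have := gap_lower crm (increasing_positions (s0^~ (u, ln (3 * (1 + h j u))))) jm.
    rewrite positionsS [positions _ j + _]addrC addrK sj lnK ?posrE //.
    rewrite [3 * _]mulrC mulfK ?pnatr_eq0 // => /(lt_le_trans _); apply.
    apply: (@lt_le_trans _ _ (1 + h j u)); first by rewrite ltrDr.
    by rewrite ler_eXnr // lerDl ltW.
  exists (fun i u => s i (u, y u)); split => //.
  - move=> i u; apply: (@continuous_comp _ _ _ (fun u => (u, y u)) (s i)).
      exact: (@cvg_pair _ _ _ (nbhs u) (nbhs u) (nbhs (y u)) _ _ _ id y cvg_id (cy u)).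
    exact: cs.
  - by move=> i u ij; rewrite shi.
  - move=> i u; rewrite leq_eqVlt => /orP[/eqP<- _|ji im]; first exact: yP.
    exact: sgi.
(* Uniqueness: [t] is the path with the left spacings and the right gaps of [s], parametrized by the
   logarithm of its [j]-th spacing. It passes through both [s] and [s'], and the [j]-th gap is
   injective along it. Past the last step, [g] takes [s i] as a positive filler. *)
pose g i := if (j < i)%N && (i.+1 < m)%N then gap cr (positions s) i else s i.
pose h i (y : R) := if i == j then expR y else g i.
have g0 i : 0 < g i.
  rewrite /g; case: ifP => // /andP[_ im]; apply: (gap_gt0 crm) => //.
  exact: increasing_positions.
have ch i : continuous (h i).
  rewrite /h; case: eqP => _; first exact: continuous_expR.
  exact: cst_continuous.
have h0 i y : 0 < h i y by rewrite /h; case: eqP => _; rewrite ?expR_gt0.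
have [t [ct t0 th tg]] := ex _ h ch h0.
have tj y : t j y = expR y by rewrite th // /h eqxx.
have ti i y : (i < j)%N -> t i y = s i.
  by move=> ij; rewrite th ?ltnS ?(ltnW ij) // /h ltn_eqF // /g ltnNge ltnW.
have tgi i y : (j < i)%N -> (i.+1 < m)%N ->
    gap cr (positions (t^~ y)) i = gap cr (positions s) i.
  by move=> ji im; rewrite tg // /h gtn_eqF // /g ji im.
have inc : forall a b, a < b ->
    gap cr (positions (t^~ a)) j < gap cr (positions (t^~ b)) j.
  apply: gap_path_increasing => //.
  - by move=> i a b ij; rewrite !ti.
  - by move=> a b ab; rewrite !tj ltr_expR.
  - by move=> i a b ji im; rewrite !tgi.
have st : forall i, (i.+1 < m)%N -> s i = t i (ln (s j)).
  apply: un => // i; last by move=> ji im; rewrite tgi.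
  rewrite ltnS leq_eqVlt => /orP[/eqP->|ij]; last by rewrite ti.
  by rewrite tj lnK ?posrE.
have s't : forall i, (i.+1 < m)%N -> s' i = t i (ln (s' j)).
  apply: un => // i; last by move=> ji im; rewrite tgi // eg // ltnW.
  rewrite ltnS leq_eqVlt => /orP[/eqP->|ij]; last by rewrite ti // e.
  by rewrite tj lnK ?posrE.
have ej : s j = s' j.
  have := eg j (leqnn j) jm.
  rewrite (eq_gap_positions jm st) (eq_gap_positions jm s't) => eq.
  rewrite -[s j]lnK ?posrE // -[s' j]lnK ?posrE //; congr expR.
  by case: (ltgtP (ln (s j)) (ln (s' j))) => // /inc; rewrite eq ltxx.
by move=> i im; rewrite st // s't // ej.
Qed.

End Solve.

(** * Types of very nice morsifications *)

Definition crit_pos (n : nat) (w : seq nat) : seq nat :=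
  [seq i <- iota 0 (size w) | ext n w i].

Definition reg_pos (n : nat) (w : seq nat) : seq nat :=
  [seq i <- iota 0 (size w) | ~~ ext n w i].

Definition types (n l : nat) : seq (seq nat * seq nat) :=
  [seq (w, b) | w <- [seq w <- permutations (iota 0 (n + l).-1) | laps n w == n],
                b <- permutations (reg_pos n w)].

Lemma size_crit_pos n w : laps n w = (size (crit_pos n w)).+1.
Proof. by rewrite size_filter. Qed.

Lemma size_reg_pos n l w : size w = (n + l).-1 -> laps n w = n ->
  size (reg_pos n w) = l.
Proof.
move=> sw; rewrite size_crit_pos => e.
have : (size (crit_pos n w) + size (reg_pos n w) = size w)%N.
  by rewrite !size_filter count_predC size_iota.
by rewrite sw; lia.
Qed.

Lemma size_types n l : size (types n l) = (num_words (n + l).-1 n * l`!)%N.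
Proof.
rewrite /types size_allpairs_dep /num_words -size_filter.
set W := [seq w <- permutations _ | _].
have : {in W, forall w, size (permutations (reg_pos n w)) = l`!}.
  move=> w; rewrite mem_filter mem_permutations => /andP[/eqP lw pw].
  rewrite size_permutations ?filter_uniq ?iota_uniq // (@size_reg_pos n l) //.
  by rewrite (perm_size pw) size_iota.
elim: W => //= w W IH h; rewrite h ?mem_head // IH ?mulSn // => v vW.
by apply: h; rewrite in_cons vW orbT.
Qed.

Lemma typesP n l w b : reflect
  [/\ perm_eq w (iota 0 (n + l).-1), laps n w = n & perm_eq b (reg_pos n w)]
  ((w, b) \in types n l).
Proof.
apply: (iffP allpairsPdep) => [[w' [b' []]]|[pw lw pb]]; last first.
  exists w, b; split => //; last by rewrite mem_permutations.
  by rewrite mem_filter lw eqxx mem_permutations.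
rewrite mem_filter !mem_permutations => /andP[/eqP lw pw] pb [-> ->].
by split.
Qed.

Lemma uniq_types n l : uniq (types n l).
Proof.
apply: allpairs_uniq_dep.
- by rewrite filter_uniq ?permutations_uniq.
- by move=> w _; apply: permutations_uniq.
- by move=> [w b] [w' b'] _ _ /= [-> ->].
Qed.

Lemma crit_pos_lt n w : all (gtn (size w)) (crit_pos n w).
Proof. by apply/allP => i; rewrite mem_filter mem_iota => /andP[]. Qed.

Lemma crit_pos_sorted n w : sorted ltn (crit_pos n w).
Proof.
by apply: sorted_filter; [exact: ltn_trans|exact: iota_ltn_sorted].
Qed.

Lemma mem_crit_pos n w i : (i \in crit_pos n w) = (i < size w)%N && ext n w i.
Proof. by rewrite mem_filter mem_iota /= andbC. Qed.

Lemma mem_reg_pos n w i : (i \in reg_pos n w) = (i < size w)%N && ~~ ext n w i.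
Proof. by rewrite mem_filter mem_iota /= andbC. Qed.

Lemma lap_sign_last (R : rcfType) m (cr : seq nat) i :
  all (gtn m) cr -> (m <= i.+1)%N -> lap_sign R cr i = 1.
Proof.
move=> /allP crm mi; rewrite /lap_sign big_seq big1 // => k /crm /= km.
by rewrite ltnNge -ltnS (leq_trans km mi) expr0.
Qed.

(** Induction from the right end, where no critical point remains and the last step goes up; moving
    left, both sides flip exactly at the extremal entries. *)
Lemma lap_sign_sig (R : rcfType) n w i : (i < size w)%N ->
  lap_sign R (crit_pos n w) i = (-1) ^+ (~~ nth true (sig n w) i.+1).
Proof.
have [d] := ubnP (size w - i); elim: d i => // d IH i di iw.
have [e|ni] := eqVneq i.+1 (size w).
  by rewrite (lap_sign_last _ (crit_pos_lt n w)) ?nth_sig_ge // e.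
have {ni}iw' : (i.+1 < size w)%N by rewrite ltn_neqAle ni.
rewrite lap_signS ?crit_pos_sorted // IH //; last by lia.
rewrite mem_crit_pos iw' andTb /ext.
move: (nth _ _ i.+1) (nth _ _ i.+2) => b c.
by case: b; case: c; rewrite /= ?expr0 ?expr1 ?mulrNN ?mulr1 ?mul1r.
Qed.

Lemma lap_sign_lt (R : rcfType) n w i : (i.+1 < size w)%N ->
  lap_sign R (crit_pos n w) i = (-1) ^+ (~~ (nth 0 w i < nth 0 w i.+1)%N).
Proof. by move=> iw; rewrite lap_sign_sig ?nth_sig // ltnW. Qed.

(** * Coefficients and derivatives of the polynomials in P_n *)

Section PnPoly.
Variables (R : realType) (n : nat).
Hypothesis n0 : (0 < n)%N.
Implicit Type lam : 'rV[R]_(n - 2).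

(** [rev_ord] appears because [lam] lists the coefficients by decreasing degree. *)
Lemma coef_Pn lam k : (Pn_poly n lam)`_k.+1 =
  (k.+1 == n)%:R + \sum_(i < n - 2) lam 0 (rev_ord i) * (k == i)%:R.
Proof.
rewrite /Pn_poly gtn_eqF // coefD coefXn; congr (_ + _).
rewrite coef_sum (reindex_inj rev_ord_inj) /=; apply: eq_bigr => i _.
rewrite coefZ coefXn; congr (_ * _%:R); congr nat_of_bool.
by have li := ltn_ord i; apply/eqP/eqP => /=; lia.
Qed.

Lemma coef_Pn_lam lam (i : 'I_(n - 2)) : (Pn_poly n lam)`_(n - 2 - i) = lam 0 i.
Proof.
have li := ltn_ord i.
have -> : (n - 2 - i = (n - 2 - i).-1.+1)%N by lia.
rewrite coef_Pn (bigD1 (rev_ord i)) //= rev_ordK.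
have -> : ((n - 2 - i).-1 == n - 2 - i.+1)%N by apply/eqP; lia.
rewrite big1 ?addr0 ?mulr1 => [|k ki].
  by rewrite (_ : (_ == n) = false) ?add0r //; apply/eqP; lia.
rewrite (_ : (_ == _) = false) ?mulr0 //; apply: contraNF ki => /eqP e.
by apply/eqP/val_inj => /=; rewrite -e; lia.
Qed.

(** The missing term of degree [n - 1] means that the critical points sum to 0, which later fixes
    the translation. *)
Lemma coef_Pn0 lam k : (n < k)%N \/ (k.+1 = n /\ (1 < n)%N) ->
  (Pn_poly n lam)`_k = 0.
Proof.
move=> h; have -> : k = k.-1.+1 by lia.
rewrite coef_Pn (_ : (_ == n) = false) ?add0r; last by apply/eqP; lia.
rewrite big1 // => i _; rewrite (_ : (_ == _) = false) ?mulr0 //.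
by have li := ltn_ord i; apply/eqP => /=; lia.
Qed.

Lemma coef_Pn1 lam : (Pn_poly n lam)`_n = 1.
Proof.
have := coef_Pn lam n.-1; rewrite prednK // => ->; rewrite eqxx big1 ?addr0 // => i _.
by rewrite (_ : (_ == _) = false) ?mulr0 //; have li := ltn_ord i; apply/eqP => /=; lia.
Qed.

Lemma size_Pn lam : size (Pn_poly n lam) = n.+1.
Proof.
apply/eqP; rewrite eqn_leq; apply/andP; split.
  by apply/leq_sizeP => k nk; apply: coef_Pn0; left.
rewrite ltnNge; apply/negP => /leq_sizeP /(_ n (leqnn n)) /eqP.
by rewrite coef_Pn1 oner_eq0.
Qed.

Lemma size_deriv_Pn lam : size (Pn_poly n lam)^`() = n.
Proof.
apply/eqP; rewrite eqn_leq; apply/andP; split.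
  by rewrite -ltnS -(size_Pn lam) lt_size_deriv // -size_poly_gt0 size_Pn.
rewrite leqNgt; apply/negP => h.
have /leq_sizeP /(_ n.-1) : (size (Pn_poly n lam)^`() <= n.-1)%N by lia.
by rewrite leqnn coef_deriv prednK // coef_Pn1 => /(_ isT)/eqP; rewrite pnatr_eq0; lia.
Qed.

Lemma lead_coef_deriv_Pn lam : lead_coef (Pn_poly n lam)^`() = n%:R.
Proof. by rewrite lead_coefE size_deriv_Pn coef_deriv prednK // coef_Pn1. Qed.

Lemma deriv_Pn_eq lam (p : {poly R}) :
  (Pn_poly n lam)^`() = p^`() <-> forall k, (Pn_poly n lam)`_k.+1 = p`_k.+1.
Proof.
split=> [e k|e]; last by apply/polyP => k; rewrite !coef_deriv e.
have := congr1 (fun q : {poly R} => q`_k) e.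
by rewrite !coef_deriv; apply: pmulrnI.
Qed.

Lemma cont_Pn : cont_poly (fun lam => Pn_poly n lam).
Proof.
move=> i; rewrite /Pn_poly gtn_eqF //.
under [X in continuous X]funext => u do rewrite coefD coef_sum.
apply: contD; first exact: cont_cst.
apply: cont_sum => k _.
under [X in continuous X]funext => u do rewrite coefZ.
apply: contM; last exact: cont_cst.
exact: coord_continuous.
Qed.

End PnPoly.

(** * The type of a very nice morsification *)

Lemma deriv_eq_diff (R : rcfType) (p q : {poly R}) a b :
  p^`() = q^`() -> p.[a] - p.[b] = q.[a] - q.[b].
Proof.
move=> e; have := @deriv_eq0 _ (p - q) a b.
by rewrite derivB e subrr => /(_ erefl); rewrite !hornerE; lra.
Qed.

(* tau = (w, b): w ranks the values along the x-axis and b_j is the index, among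
   all marked points, of the j-th boundary point. *)
Definition has_type (R : realType) (n l : nat) (tau : seq nat * seq nat) :
    set (morsif R n l) :=
  [set p : morsif R n l | exists x : nat -> R,
   [/\ increasing (size tau.1) x,
       (Pn_poly n p.1)^`() = n%:R *: dcrit (crit_pos n tau.1) x,
       forall j : 'I_l, p.2 0 j = x (nth 0%N tau.2 j) &
       forall i k, (i < size tau.1)%N -> (k < size tau.1)%N ->
         ((Pn_poly n p.1).[x i] < (Pn_poly n p.1).[x k]) =
           (nth 0%N tau.1 i < nth 0%N tau.1 k)%N]].
Arguments has_type R n l tau p : clear implicits.

Lemma increasing_inj (R : rcfType) m (x : nat -> R) i k : increasing m x ->
  (i < m)%N -> (k < m)%N -> x i = x k -> i = k.
Proof.
move=> xi im km e; case: (ltngtP i k) => // h.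
  by have := xi i k; rewrite h km e ltxx => /(_ isT).
by have := xi k i; rewrite h im e ltxx => /(_ isT).
Qed.

Lemma increasing_sorted (R : rcfType) m (x : nat -> R) : increasing m x ->
  sorted <%R (mkseq x m).
Proof.
move=> xi; apply: (@homo_sorted_in _ _ (gtn m) x ltn <%R); last 2 first.
- by apply/allP => i; rewrite mem_iota => /andP[].
- exact: iota_ltn_sorted.
by move=> i k _ km ik; apply: xi; apply/andP; split.
Qed.

Lemma map_crit_reg (T : eqType) n w (x : nat -> T) b :
  perm_eq b (reg_pos n w) ->
  perm_eq (map x (crit_pos n w) ++ map x b) (mkseq x (size w)).
Proof.
move=> pb; rewrite -map_cat; apply: perm_map.
rewrite perm_sym -(perm_filterC (ext n w)) perm_cat2l perm_sym.
exact: pb.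
Qed.

Lemma boundary_seq (T : eqType) l b (x : nat -> T) (v : 'I_l -> T) :
  size b = l -> (forall j : 'I_l, v j = x (nth 0%N b j)) ->
  [seq v j | j <- enum 'I_l] = map x b.
Proof.
move=> sb e; apply: (@eq_from_nth _ (x 0%N)); first by rewrite size_map size_enum_ord size_map sb.
move=> i; rewrite size_map size_enum_ord => il.
rewrite (nth_map (Ordinal il)) ?size_enum_ord // (nth_map 0%N) ?sb // e.
by rewrite nth_enum_ord.
Qed.

Lemma prod_sign (R : nzRingType) (I : Type) (P : pred I) (s : seq I) :
  \prod_(k <- s) (-1) ^+ P k = (-1) ^+ odd (count P s) :> R.
Proof.
elim: s => [|k s IH]; first by rewrite big_nil expr0.
by rewrite big_cons IH /= oddD signr_addb; case: (P k).
Qed.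

Lemma map_index (T : eqType) (s : seq T) : uniq s ->
  map (index^~ s) s = iota 0 (size s).
Proof.
move=> us; case: s us => // x0 s' us; set s := x0 :: s'.
apply: (@eq_from_nth _ 0%N); rewrite ?size_map ?size_iota // => i il.
by rewrite (nth_map x0) // index_uniq // nth_iota.
Qed.

Section TypesOfMorsifications.
Variables (R : realType) (n l : nat).
Hypothesis n0 : (0 < n)%N.

Lemma types_size w b : (w, b) \in types n l ->
  size w = (n + l).-1 /\ size b = l.
Proof.
move=> /typesP[pw lw pb]; have sw : size w = (n + l).-1.
  by rewrite (perm_size pw) size_iota.
by split=> //; rewrite (perm_size pb) (size_reg_pos sw lw).
Qed.

Lemma type_nth_inj w b i k : (w, b) \in types n l -> (i < size w)%N ->
  (k < size w)%N -> nth 0%N w i = nth 0%N w k -> i = k.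
Proof.
move=> /typesP[pw _ _] iw kw /eqP; rewrite nth_uniq //; first by move=> /eqP.
by rewrite (perm_uniq pw) iota_uniq.
Qed.

Lemma has_type_very_nice tau p : tau \in types n l ->
  has_type R n l tau p -> very_nice_M R n l p.
Proof.
case: tau => w b tw [x /= [xi dp pb vo]].
have [sw sb] := types_size tw; have [pw lw pb'] := typesP _ _ _ _ tw.
have sc : size (map x (crit_pos n w)) == n.-1.
  by rewrite size_map -[n in n.-1]lw size_crit_pos.
exists (Tuple sc) => /=.
  rewrite /real_critical_points lead_coef_deriv_Pn // dp /dcrit.
  by rewrite big_map.
rewrite (map_comp _ (fun i => p.2 0 i)) (boundary_seq sb pb) -map_cat.
rewrite (perm_uniq (perm_map _ (map_crit_reg x pb'))) map_inj_in_uniq.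
  rewrite map_inj_in_uniq ?iota_uniq // => i k; rewrite !mem_iota /= => iw kw.
  exact: (increasing_inj xi).
move=> _ _ /mapP[i iw ->] /mapP[k kw ->].
move: iw kw; rewrite !mem_iota /= => iw kw e; congr x.
apply: (type_nth_inj tw) => //.
have h1 := vo i k iw kw; have h2 := vo k i kw iw; rewrite e ltxx in h1 h2.
by case: ltngtP h1 h2.
Qed.

(** The set of marked points is intrinsic: roots of the derivative and boundary points. So its
    increasing enumeration is unique; [w] is then recovered by counting smaller values, and [b] by
    locating the boundary points. *)
Lemma has_type_inj tau tau' p : tau \in types n l -> tau' \in types n l ->
  has_type R n l tau p -> has_type R n l tau' p -> tau = tau'.
Proof.
case: tau tau' => w b [w' b'] tw tw' [x /= [xi dp pb vo]] [x' /= [xi' dp' pb' vo']].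
have [sw sb] := types_size tw; have [pw lw pB] := typesP _ _ _ _ tw.
have [sw' sb'] := types_size tw'; have [pw' lw' pB'] := typesP _ _ _ _ tw'.
rewrite sw in xi vo; rewrite sw' in xi' vo'.
have mem (y : nat -> R) v c : perm_eq c (reg_pos n v) -> size v = (n + l).-1 ->
    size c = l -> (Pn_poly n p.1)^`() = n%:R *: dcrit (crit_pos n v) y ->
    (forall j : 'I_l, p.2 0 j = y (nth 0%N c j)) ->
    mkseq y (n + l).-1 =i
      [pred z | root (Pn_poly n p.1)^`() z || (z \in [seq p.2 0 j | j <- enum 'I_l])].
  move=> pc sv sc dv bv z; rewrite -sv -(perm_mem (map_crit_reg y pc)) mem_cat inE.
  by rewrite dv rootZ ?pnatr_eq0 -?lt0n // root_dcrit (boundary_seq sc bv).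
have ex : mkseq x (n + l).-1 = mkseq x' (n + l).-1.
  apply: (irr_sorted_eq lt_trans ltxx); rewrite ?increasing_sorted // => z.
  by rewrite (mem x w b) // (mem x' w' b').
have exi i : (i < (n + l).-1)%N -> x i = x' i.
  by move=> il; rewrite -(nth_mkseq 0 x il) ex nth_mkseq.
have wr v c : (v, c) \in types n l -> forall i, (i < (n + l).-1)%N ->
    nth 0%N v i = count (fun k => nth 0%N v k < nth 0%N v i)%N (iota 0 (n + l).-1).
  move=> tv i il; have [sv _] := types_size tv; have [pv _ _] := typesP _ _ _ _ tv.
  rewrite -sv -(count_map (nth 0%N v) (fun z => z < nth 0%N v i)%N).
  rewrite -/(mkseq (nth 0%N v) (size v)) mkseq_nth (permP pv).
  have : (nth 0%N v i <= (n + l).-1)%N.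
    have : nth 0%N v i \in v by rewrite mem_nth // sv.
    by rewrite (perm_mem pv) mem_iota /= => /ltnW.
  move: (nth _ _ _) (n + l).-1 => a q aq.
  rewrite -(subnKC aq) iotaD count_cat add0n [X in (_ + X)%N](_ : _ = 0%N); last first.
    apply/eqP; rewrite -leqn0 leqNgt -has_count; apply/hasPn => z.
    by rewrite mem_iota -leqNgt => /andP[].
  rewrite addn0; apply/esym; rewrite -[RHS](size_iota 0); apply/eqP.
  by rewrite -all_count; apply/allP => z; rewrite mem_iota.
have ew : w = w'.
  apply: (@eq_from_nth _ 0%N); rewrite ?sw ?sw' // => i il.
  rewrite (wr _ _ tw) // (wr _ _ tw') //; apply: eq_in_count => k.
  by rewrite mem_iota /= => kl; rewrite -vo // -vo' // !exi.
congr pair => //; apply: (@eq_from_nth _ 0%N); rewrite ?sb ?sb' // => i il.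
have blt c v : perm_eq c (reg_pos n v) -> size v = (n + l).-1 -> size c = l ->
    (nth 0%N c i < (n + l).-1)%N.
  move=> pc sv sc; have : nth 0%N c i \in c by rewrite mem_nth // sc.
  by rewrite (perm_mem pc) mem_reg_pos sv => /andP[].
apply: (increasing_inj xi); [exact: (blt b w)|exact: (blt b' w')|].
by rewrite -(pb (Ordinal il)) (pb' (Ordinal il)) exi //; exact: (blt b' w').
Qed.

(** Sorting the marked points gives [x], and ranking their values gives [w]. The main point is that
    the turns of [w] are exactly the critical points. *)
Lemma very_nice_has_type p : very_nice_M R n l p ->
  exists2 tau, tau \in types n l & has_type R n l tau p.
Proof.
case=> cs; set f := Pn_poly n p.1 => rc uv.
have {}rc : f^`() = n%:R *: \prod_(c <- cs) ('X - c%:P).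
  by rewrite {1}rc lead_coef_deriv_Pn.
pose bs := [seq p.2 0 j | j <- enum 'I_l].
have sbs : size bs = l by rewrite size_map size_enum_ord.
pose xs := sort <=%R (cs ++ bs); pose m := (n + l).-1.
have sxs : size xs = m.
  rewrite size_sort size_cat size_tuple sbs /m; lia.
have pxs : perm_eq xs (cs ++ bs) by rewrite perm_sort.
rewrite (map_comp _ (fun i => p.2 0 i)) -map_cat -/bs in uv.
have uxs : uniq (map (horner f) xs) by rewrite (perm_uniq (perm_map _ pxs)).
have ux : uniq xs by apply: map_uniq uxs.
have ucb : uniq (cs ++ bs) by rewrite -(perm_uniq pxs).
have sx : sorted <%R xs by rewrite lt_sorted_uniq_le ux sort_le_sorted.
pose x := nth 0 xs.
have xi : increasing m x.
  move=> i k /andP[ik km]; rewrite /x.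
  by apply: (sorted_ltn_nth lt_trans) => //; rewrite inE sxs // (ltn_trans ik).
have mkx : mkseq x m = xs by rewrite -sxs mkseq_nth.
pose cr := [seq i <- iota 0 m | x i \in cs].
have crm : all (gtn m) cr.
  by apply/allP => i; rewrite mem_filter mem_iota => /andP[_ /andP[]].
have crS : sorted ltn cr.
  by apply: sorted_filter; [exact: ltn_trans|exact: iota_ltn_sorted].
have mcr i : (i \in cr) = (i < m)%N && (x i \in cs).
  by rewrite mem_filter mem_iota /= andbC.
have pcr : perm_eq (map x cr) cs.
  rewrite -[map x cr]/(map x [seq i <- iota 0 m | preim x (mem cs) i]) -filter_map.
  rewrite -/(mkseq x m) mkx; apply: uniq_perm.
  - exact: filter_uniq.
  - by move: ucb; rewrite cat_uniq => /andP[].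
  - move=> z; rewrite mem_filter (perm_mem pxs) mem_cat /=.
    by case: (z \in cs).
have scr : size cr = n.-1 by rewrite -(size_map x) (perm_size pcr) size_tuple.
have df : f^`() = n%:R *: dcrit cr x.
  by rewrite rc /dcrit -(big_map x predT (fun c => 'X - c%:P)) (perm_big _ pcr).
have diff a b : f.[a] - f.[b] = (pcrit cr x).[a] - (pcrit cr x).[b].
  by apply: deriv_eq_diff; rewrite deriv_pcrit df scr prednK.
pose S := sort <=%R (map (horner f) xs).
have pS : perm_eq S (map (horner f) xs) by rewrite perm_sort.
have uS : uniq S by rewrite (perm_uniq pS).
have sS : sorted <%R S by rewrite lt_sorted_uniq_le uS sort_le_sorted.
pose w := [seq index f.[z] S | z <- xs].
have sw : size w = m by rewrite size_map.
have wi i : (i < m)%N -> nth 0%N w i = index f.[x i] S.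
  by move=> im; rewrite (nth_map 0) ?sxs.
have inS i : (i < m)%N -> f.[x i] \in S.
  by move=> im; rewrite (perm_mem pS) map_f // mem_nth // sxs.
have vo i k : (i < m)%N -> (k < m)%N ->
    (f.[x i] < f.[x k]) = (nth 0%N w i < nth 0%N w k)%N.
  move=> im km; rewrite !wi //; apply/idP/idP => [h|]; last first.
    by apply: (sorted_ltn_index lt_trans) => //; apply: inS.
  rewrite ltnNge leq_eqVlt; apply/negP => /orP[/eqP e|e].
    move: h; rewrite -(nth_index 0 (inS i im)) -(nth_index 0 (inS k km)) e.
    by rewrite ltxx.
  have := sorted_ltn_index lt_trans sS _ _ (inS k km) (inS i im) e.
  by move=> /(lt_trans h); rewrite ltxx.
have pw : perm_eq w (iota 0 m).
  have -> : w = map (index^~ S) (map (horner f) xs) by rewrite -map_comp.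
  have -> : iota 0 m = map (index^~ S) S.
    by rewrite map_index // (perm_size pS) size_map sxs.
  by apply: perm_map; rewrite perm_sym.
(* Parity of the number of critical points from the [i]-th marked point on: the step arriving there
   goes up exactly when this number is even. At [i = 0] there are [n - 1] of them, in accordance
   with the infinity chosen on the left. *)
pose D i := odd (count (leq i) cr).
have DS i : D i = (i \in cr) (+) D i.+1.
  apply: (@signr_inj R); rewrite signr_addb /D -!prod_sign.
  by rewrite (prod_sign_leq R crS).
have sgn i : (i <= m)%N -> nth true (sig n w) i = ~~ D i.
  case: i => [_|i]; first by rewrite /D /= count_predT scr; case: n n0.
  rewrite leq_eqVlt => /orP[/eqP e|im].
    rewrite nth_sig_ge ?sw -?e // e /D.
    have -> : count (leq m) cr = 0%N; last by [].
    apply/eqP; rewrite -leqn0 leqNgt -has_count; apply/hasPn => k /(allP crm) /=.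
    by rewrite ltnNge.
  rewrite nth_sig ?sw // -vo ?(ltnW im) //.
  have := gap_gt0 crm xi im; rewrite /gap -diff /lap_sign prod_sign -/(D i.+1).
  case: (D i.+1); rewrite ?expr1 ?expr0 ?mulN1r ?mul1r ?oppr_gt0 ?subr_gt0 //.
  by rewrite subr_lt0 => h; apply/negbTE; rewrite -leNgt ltW.
have extE i : (i < m)%N -> ext n w i = (i \in cr).
  move=> im; rewrite /ext !sgn ?(ltnW im) // (DS i).
  by case: (_ \in _); case: (D i.+1).
have crE : crit_pos n w = cr.
  rewrite /crit_pos sw; apply: eq_in_filter => i; rewrite mem_iota /= => im.
  by rewrite extE // mcr im.
have lw : laps n w = n by rewrite size_crit_pos crE scr prednK.
pose b := [seq index z xs | z <- bs].
have bxs z : z \in bs -> z \in xs.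
  by move=> zb; rewrite (perm_mem pxs) mem_cat zb orbT.
have pb : perm_eq b (reg_pos n w).
  apply: uniq_perm; last 1 first.
  - move=> i; rewrite mem_reg_pos sw; apply/mapP/andP => [[z zb ->]|[im]].
      have zx := bxs z zb; have ilt : (index z xs < m)%N by rewrite -sxs index_mem.
      split=> //; rewrite extE // mcr ilt /= /x nth_index //.
      move: ucb; rewrite cat_uniq => /and3P[_ /hasPn h _].
      exact: h.
    rewrite extE // mcr im /= => xn; exists (x i); last by rewrite index_uniq ?sxs.
    have : x i \in xs by rewrite mem_nth // sxs.
    by rewrite (perm_mem pxs) mem_cat (negbTE xn).
  - rewrite map_inj_in_uniq; first by move: ucb; rewrite cat_uniq => /and3P[].
    by move=> y z /bxs yx /bxs zx e; rewrite -(nth_index 0 yx) e nth_index.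
  - by rewrite filter_uniq ?iota_uniq.
exists (w, b); first by apply/typesP.
exists x => /=; rewrite sw crE; split => // j.
have hj : (j < size bs)%N by rewrite sbs.
rewrite /b (nth_map 0) // /x nth_index; last by apply: bxs; rewrite mem_nth.
by rewrite (nth_map j) ?size_enum_ord // nth_ord_enum.
Qed.

End TypesOfMorsifications.

(** * Openness of the set of morsifications of a given type *)

Section OpenTypes.
Variables (R : realType) (n l : nat).
Hypothesis n0 : (0 < n)%N.

Let F (q : morsif R n l * R) : R := (Pn_poly n q.1.1).[q.2].

Lemma cont_Pn_horner (V : topologicalType) (p : V -> morsif R n l) (z : V -> R) :
  continuous p -> continuous z ->
  continuous (fun v => (Pn_poly n (p v).1).[z v]).
Proof.
move=> cp cz; apply: (@cont_horner _ _ _ _ n.+1) => // [i|u]; last by rewrite size_Pn.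
move=> v; apply: (@continuous_comp _ _ _ (fun v => (p v).1)
   (fun lam => (Pn_poly n lam)`_i)); last exact: cont_Pn.
by apply: (@continuous_comp _ _ _ p fst); [exact: cp|exact: cvg_fst].
Qed.

Lemma cont_deriv_Pn_horner z :
  continuous (fun p : morsif R n l => (Pn_poly n p.1)^`().[z]).
Proof.
apply: (@cont_horner _ _ _ _ n) => [i|u|]; [|by rewrite size_deriv_Pn|exact: cont_cst].
under [X in continuous X]funext => u do rewrite coef_deriv -mulr_natr.
apply: contM; last exact: cont_cst.
move=> v; apply: (@continuous_comp _ _ _ fst
   (fun lam => (Pn_poly n lam)`_i.+1)); last exact: cont_Pn.
exact: cvg_fst.
Qed.

(** Joint continuity in the polynomial and the point, with the average of the two values as
    threshold. Since it holds for all small [e], finitely many comparisons can share one [e]. *)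
Lemma near_horner_lt (p0 : morsif R n l) (a b : R) :
  (Pn_poly n p0.1).[a] < (Pn_poly n p0.1).[b] ->
  \forall e \near 0^'+, \forall p \near p0, forall y z,
    `|y - a| < e -> `|z - b| < e -> (Pn_poly n p.1).[y] < (Pn_poly n p.1).[z].
Proof.
move=> ab; set c := ((Pn_poly n p0.1).[a] + (Pn_poly n p0.1).[b]) / 2.
have cF : continuous F.
  apply: (@cont_Pn_horner _ fst snd) => v; [exact: cvg_fst|exact: cvg_snd].
have [|[A1 B1] /= [nA1 nB1] h1] := cvgr_lt _ (cF (p0, a)) c; first by rewrite /F /c /=; lra.
have [|[A2 B2] /= [nA2 nB2] h2] := cvgr_gt _ (cF (p0, b)) c; first by rewrite /F /c /=; lra.
have [d1 /= d10 hd1] := nB1; have [d2 /= d20 hd2] := nB2.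
near=> e.
have e1 : e < d1 by near: e; apply: nbhs_right_lt.
have e2 : e < d2 by near: e; apply: nbhs_right_lt.
have : nbhs p0 (A1 `&` A2) by apply: filterI.
apply: filterS => p [Ap1 Ap2] y z ya zb.
apply: (@lt_trans _ _ c).
  apply: (h1 (p, y)); split => //=; apply: hd1 => /=.
  by rewrite distrC (lt_trans ya).
apply: (h2 (p, z)); split => //=; apply: hd2 => /=.
by rewrite distrC (lt_trans zb).
Unshelve. all: by end_near. Qed.

(** Only the factor of [i] changes sign, the other roots being further away than [e]. Such a sign
    change persists when the polynomial is perturbed. *)
Lemma dcrit_sign_change (cr : seq nat) m (x : nat -> R) i e :
  all (gtn m) cr -> increasing m x -> uniq cr -> i \in cr -> 0 < e ->
  (forall j k, (j < k < m)%N -> e < x k - x j) ->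
  (dcrit cr x).[x i - e] * (dcrit cr x).[x i + e] < 0.
Proof.
move=> crm xi uc ic e0 xe; rewrite /dcrit !horner_prod -big_split /=.
rewrite (bigD1_seq i) //= !hornerE /=.
have -> : (x i - e - x i) * (x i + e - x i) = - (e * e) by ring.
rewrite mulNr oppr_lt0 mulr_gt0 ?mulr_gt0 //.
rewrite big_seq_cond prodr_gt0 // => k /andP[kc ki]; rewrite !hornerE.
have -> : (x i - e - x k) * (x i + e - x k) = (x i - x k - e) * (x i - x k + e) by ring.
have km : (k < m)%N by move/allP: crm => /(_ k kc).
have im : (i < m)%N by move/allP: crm => /(_ i ic).
case: (ltngtP i k) => ik; last by rewrite ik eqxx in ki.
  by rewrite nmulr_rgt0; have := xe i k; rewrite ik km => /(_ isT); lra.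
by rewrite mulr_gt0 //; have := xe k i; rewrite ik im => /(_ isT); lra.
Qed.

Lemma open_has_type tau : tau \in types n l -> open (has_type R n l tau).
Proof.
case: tau => w b tw; rewrite openE => p0 [x /= [xi dp pb vo]]; rewrite /interior.
have [sw sb] := types_size tw; have [pw lw pB] := typesP _ _ _ _ tw.
set m := size w in xi vo *; set cr := crit_pos n w in dp *.
have crm : all (gtn m) cr := crit_pos_lt n w.
have ucr : uniq cr by rewrite filter_uniq ?iota_uniq.
have scr : (size cr).+1 = n by rewrite -size_crit_pos.
(* The radius [e] makes the windows around the marked points disjoint and lets each comparison of
   values hold throughout two windows. *)
have : \forall e \near (0 : R)^'+, 0 < e /\
   (forall i k : 'I_m, (i < k)%N -> 2 * e < x k - x i) /\
   (forall i k : 'I_m, (nth 0%N w i < nth 0%N w k)%N -> \forall p \near p0, forall y z,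
    `|y - x i| < e -> `|z - x k| < e -> (Pn_poly n p.1).[y] < (Pn_poly n p.1).[z]).
  near=> e; split; first by near: e; exact: nbhs_right_gt.
  split.
    near: e; apply: filter_forall => i; apply: filter_forall => k.
    case: (boolP (i < k)%N) => ik; last by apply: nearW.
    have xik : 0 < (x k - x i) / 2 by rewrite divr_gt0 // subr_gt0 xi // ik /=.
    near=> e => _; have : e < (x k - x i) / 2 by near: e; apply: nbhs_right_lt.
    lra.
  near: e; apply: filter_forall => i; apply: filter_forall => k.
  case: (boolP (nth 0%N w i < nth 0%N w k)%N) => ik; last by apply: nearW.
  have := @near_horner_lt p0 (x i) (x k); rewrite vo ?ik // => /(_ isT).
  by apply: filterS => e he _.
move=> /filter_ex[e [e0 [xe vw]]].
have xe' j k : (j < k < m)%N -> 2 * e < x k - x j.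
  move=> /andP[jk km]; have jm : (j < m)%N := ltn_trans jk km.
  exact: (xe (Ordinal jm) (Ordinal km)).
near=> p.
have hv i k y z : (i < m)%N -> (k < m)%N -> (nth 0%N w i < nth 0%N w k)%N ->
    `|y - x i| < e -> `|z - x k| < e -> (Pn_poly n p.1).[y] < (Pn_poly n p.1).[z].
  move=> im km wik; move: y z; rewrite -[i]/(val (Ordinal im)) -[k]/(val (Ordinal km)).
  move: wik; rewrite -[i]/(val (Ordinal im)) -[k]/(val (Ordinal km)).
  move: (Ordinal im) (Ordinal km); near: p.
  apply: filter_forall => i'; apply: filter_forall => k'.
  case: (boolP (nth 0%N w i' < nth 0%N w k')%N) => ik; last by apply: nearW.
  by apply: filterS (vw i' k' ik) => p hp _.
have hb (j : 'I_l) : `|p.2 0 j - x (nth 0%N b j)| < e.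
  move: j; near: p; apply: filter_forall => j; rewrite -pb.
  have cj : continuous (fun p : morsif R n l => p.2 0 j).
    move=> q; apply: (@continuous_comp _ _ _ snd (fun v : 'rV[R]_l => v 0 j)).
      exact: cvg_snd.
    exact: coord_continuous.
  by have /cvgrPdist_lt /(_ e e0) := cj p0; apply: filterS => q; rewrite distrC.
have hr i : (i < m)%N -> i \in cr ->
    (Pn_poly n p.1)^`().[x i - e] * (Pn_poly n p.1)^`().[x i + e] < 0.
  move=> im; rewrite -[i]/(val (Ordinal im)); move: (Ordinal im); near: p.
  apply: filter_forall => i'; case: (boolP (val i' \in cr)) => ic; last by apply: nearW.
  have cd : continuous (fun p : morsif R n l =>
      (Pn_poly n p.1)^`().[x i' - e] * (Pn_poly n p.1)^`().[x i' + e]).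
    by apply: contM; apply: cont_deriv_Pn_horner.
  have : (Pn_poly n p0.1)^`().[x i' - e] * (Pn_poly n p0.1)^`().[x i' + e] < 0.
    rewrite dp !hornerZ mulrACA pmulr_rlt0 ?mulr_gt0 ?ltr0n //.
    apply: (dcrit_sign_change crm xi) => // j k jk.
    by have := xe' j k jk; lra.
  by move=> /(cvgr_lt _ (cd p0)); apply: filterS.
have [y yP] : exists y : nat -> R, forall i, (i < m)%N -> `|y i - x i| < e /\
    if i \in cr then is_true (root (Pn_poly n p.1)^`() (y i))
    else forall j : 'I_l, nth 0%N b j = i -> y i = p.2 0 j.
  have ex (i : nat) : exists z : R, (i < m)%N -> `|z - x i| < e /\
    if i \in cr then is_true (root (Pn_poly n p.1)^`() z)
    else forall j : 'I_l, nth 0%N b j = i -> z = p.2 0 j.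
    case: (ltnP i m) => im; last by exists 0.
    case: (boolP (i \in cr)) => ic.
      have le : x i - e <= x i + e by lra.
      have [z zi rz] := polyrcf.poly_ivtoo le (hr i im ic).
      exists z => _; split=> //; move: zi; rewrite in_itv /= => /andP[z1 z2].
      by rewrite ltr_norml; lra.
    have ib : i \in b.
      by rewrite (perm_mem pB) mem_reg_pos im; move: ic; rewrite mem_crit_pos im.
    have il : (index i b < l)%N by rewrite -sb index_mem.
    exists (p.2 0 (Ordinal il)) => _; split.
      by have := hb (Ordinal il); rewrite /= nth_index.
    move=> j ej; congr (p.2 0 _); apply: val_inj => /=.
    rewrite -ej index_uniq ?sb //.
    by rewrite (perm_uniq pB) filter_uniq ?iota_uniq.
  by have [y yP] := choice ex; exists y.
have yx i : (i < m)%N -> `|y i - x i| < e by move=> /yP[].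
have yi : increasing m y.
  move=> i k /[dup] ikm /andP[ik km]; have := xe' i k ikm.
  by have := yx i (ltn_trans ik km); have := yx k km; rewrite !ltr_norml; lra.
exists y => /=; split => //.
(* The windows provide [n - 1] distinct roots of a derivative of degree [n - 1], hence all of
   them. *)
- have := @all_roots_prod_XsubC _ (Pn_poly n p.1)^`() (map y cr).
  rewrite lead_coef_deriv_Pn // /dcrit big_map; apply.
  + by rewrite size_deriv_Pn // size_map.
  + apply/allP => _ /mapP[i ic ->]; have im : (i < m)%N := allP crm i ic.
    by have [_] := yP i im; rewrite ic.
  + rewrite uniq_rootsE map_inj_in_uniq // => i k ic kc.
    by apply: (increasing_inj yi); apply: (allP crm).
- move=> j; have jb : nth 0%N b j \in b by rewrite mem_nth // sb.
  have : nth 0%N b j \in reg_pos n w by rewrite -(perm_mem pB).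
  rewrite mem_reg_pos => /andP[jm je]; have [_] := yP _ jm.
  by rewrite mem_crit_pos (negbTE je) andbF => /(_ j erefl).
- move=> i k im km; apply/idP/idP => [|wik]; last by apply: (hv i k) => //; apply: yx.
  apply: contraTT; rewrite -leqNgt leq_eqVlt => /orP[/eqP e'|wki].
    by rewrite (type_nth_inj tw km im e') ltxx.
  by rewrite -leNgt ltW //; apply: (hv k i) => //; apply: yx.
Unshelve. all: by end_near. Qed.

End OpenTypes.

(** * Realization of prescribed values and connectedness of types *)

Lemma eq_dcrit (R : rcfType) (cr : seq nat) (x x' : nat -> R) :
  {in cr, x =1 x'} -> dcrit cr x = dcrit cr x'.
Proof. by move=> e; rewrite /dcrit !big_seq; apply: eq_bigr => k /e->. Qed.

Lemma dcrit_coef_sum (R : rcfType) (cr : seq nat) (x : nat -> R) :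
  size cr != 0%N -> (dcrit cr x)`_(size cr).-1 = - \sum_(k <- cr) x k.
Proof.
move=> c0; have := @coefPn_prod_XsubC _ (map x cr).
by rewrite size_map big_map /dcrit => -> //; rewrite big_map.
Qed.

Lemma cont_row (R : realType) (U : topologicalType) k (g : 'I_k -> U -> R) :
  (forall i, continuous (g i)) -> continuous (fun u => \row_i g i u : 'rV[R]_k).
Proof.
move=> cg u A [P nP PA].
have : \forall v \near u, forall (i : 'I_1) (j : 'I_k), P i j (g j v).
  apply: filter_forall => i; apply: filter_forall => j; apply: (cg j u).
  by have := nP i j; rewrite mxE.
by apply: filterS => v hv; apply: PA => i j; rewrite mxE.
Qed.

Section Realization.
Variables (R : realType) (n l : nat).
Hypothesis n0 : (0 < n)%N.

(** The primitive [pcrit cr x] is monic without constant term, and its term of degree [n - 1]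
    vanishes when the critical points sum to 0; so it lies in P_n. *)
Lemma Pn_of_pcrit (cr : seq nat) (x : nat -> R) : (size cr).+1 = n ->
  (n != 1%N -> \sum_(k <- cr) x k = 0) ->
  (Pn_poly n (\row_i (pcrit cr x)`_(n - 2 - i)))^`() = n%:R *: dcrit cr x.
Proof.
move=> scr sx; have -> : n%:R *: dcrit cr x = (pcrit cr x)^`().
  by rewrite deriv_pcrit scr.
apply/deriv_Pn_eq => // k.
rewrite coef_Pn //.
have -> : \sum_(i < n - 2) (\row_i (pcrit cr x)`_(n - 2 - i)) 0 (rev_ord i) * (k == i)%:R =
   if (k < n - 2)%N then (pcrit cr x)`_k.+1 else 0.
  case: ifP => kn.
    rewrite (bigD1 (Ordinal kn)) //= eqxx mulr1 mxE /= big1 ?addr0; last first.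
      move=> i ik; rewrite (_ : (_ == _) = false) ?mulr0 //.
      by apply: contraNF ik => /eqP e; apply/eqP/val_inj.
    by congr (_`__); lia.
  rewrite big1 // => i _; rewrite (_ : (_ == _) = false) ?mulr0 //.
  by apply: contraFF kn => /eqP->.
rewrite coef_primitive coefZ /=.
have sd := size_dcrit cr x.
have [e|ne] := eqVneq k.+1 n.
  rewrite ifF; last by lia.
  have := monic_dcrit cr x; rewrite monicE lead_coefE sd /= => /eqP.
  have -> : size cr = k by lia.
  by move=> ->; rewrite addr0 mulr1 divff // pnatr_eq0.
rewrite add0r; case: ltnP => // kn.
have [e|ne'] := eqVneq k.+2 n.
  have ek : (size cr).-1 = k by lia.
  by rewrite -{1}ek dcrit_coef_sum ?sx ?oppr0 ?mulr0 ?mul0r //; lia.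
by rewrite nth_default ?mulr0 ?mul0r // sd; lia.
Qed.

(* The base point a0 is needed for n = 1 only, when no critical point fixes the
   translation. *)
Lemma realize w b (U : topologicalType) (y : nat -> U -> R) (a0 : U -> R) :
  (w, b) \in types n l -> (0 < (n + l).-1)%N ->
  (forall i, continuous (y i)) -> continuous a0 ->
  (forall u i k, (i < size w)%N -> (k < size w)%N ->
    (y i u < y k u) = (nth 0 w i < nth 0 w k)%N) ->
  exists Psi : U -> morsif R n l,
   [/\ continuous Psi, forall u, has_type R n l (w, b) (Psi u) &
     forall u (p : morsif R n l) (x : nat -> R), increasing (size w) x ->
      (Pn_poly n p.1)^`() = n%:R *: dcrit (crit_pos n w) x ->
      (forall j : 'I_l, p.2 0 j = x (nth 0%N b j)) ->
      (forall i k, (i < size w)%N -> (k < size w)%N ->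
        (Pn_poly n p.1).[x i] - (Pn_poly n p.1).[x k] = y i u - y k u) ->
      (n = 1%N -> x 0%N = a0 u) -> Psi u = p].
Proof.
move=> tw m0 cy ca0 yo.
have [sw sb] := types_size tw; have [pw lw pB] := typesP _ _ _ _ tw.
set m := size w in yo *; set cr := crit_pos n w.
rewrite -sw -/m in m0.
have crm : all (gtn m) cr := crit_pos_lt n w.
have crS : sorted ltn cr := crit_pos_sorted n w.
have scr : (size cr).+1 = n by rewrite -size_crit_pos.
(* These are the gaps prescribed by [y], with 1 as a positive filler past the last step. *)
pose h i u := if (i.+1 < m)%N then lap_sign R cr i * (y i.+1 u - y i u) else 1.
have ch i : continuous (h i).
  rewrite /h; case: (i.+1 < m)%N; last exact: cont_cst.
  by apply: contM; [exact: cont_cst|exact: contB].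
have h0 i u : 0 < h i u.
  rewrite /h; case: ifP => // im; rewrite lap_sign_lt //.
  have := yo u i i.+1 (ltnW im) im; have := yo u i.+1 i im (ltnW im).
  case: (ltngtP (nth 0%N w i) (nth 0%N w i.+1)) => [_ _ h1|_ h1 _|e].
  - by rewrite expr0 mul1r subr_gt0.
  - by rewrite expr1 mulN1r oppr_gt0 subr_lt0.
  - by have /eqP := type_nth_inj tw (ltnW im) im e; rewrite ltn_eqF.
have [|ex un] := @solve_spacings R m cr crm crS m.-1 0%N; first by rewrite add0n prednK.
have [s [cs s0 _ sg]] := ex U h ch h0.
pose P i u := positions (s^~ u) i.
have cP i : continuous (P i) by apply: cont_positions.
(* For [n] other than 1, this translation makes the critical points sum to 0. *)
pose a u := if n == 1%N then a0 u else - (\sum_(k <- cr) P k u) * (size cr)%:R^-1.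
have ca : continuous a.
  rewrite /a; case: eqP => // _; apply: contM; last exact: cont_cst.
  by apply: contN; apply: cont_sum.
pose x i u := P i u + a u.
have cx i : continuous (x i) by apply: contD.
have xi u : increasing m (x^~ u).
  by move=> i k ik; rewrite /x ltrD2r; apply: increasing_positions ik.
have sx u : n != 1%N -> \sum_(k <- cr) x k u = 0.
  move=> n1; rewrite big_split /= big_const_seq count_predT iter_addr_0 /a.
  rewrite (negbTE n1) -[_ *+ _]mulr_natr divfK ?subrr //.
  by rewrite pnatr_eq0; move: n1; rewrite -scr.
pose Psi u : morsif R n l :=
  (\row_i (pcrit cr (x^~ u))`_(n - 2 - i), \row_j x (nth 0%N b j) u).
have dPsi u : (Pn_poly n (Psi u).1)^`() = n%:R *: dcrit cr (x^~ u).
  by apply: Pn_of_pcrit => //; apply: sx.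
have dy u i : (i < m)%N ->
    (pcrit cr (P^~ u)).[P i u] - (pcrit cr (P^~ u)).[P 0%N u] = y i u - y 0%N u.
  elim: i => [|i IH] im; first by rewrite !subrr.
  have := sg i u (leq0n i) im; rewrite /h im /gap => /(congr1 ( *%R (lap_sign R cr i))).
  rewrite !lap_signM -/(P i.+1 u) -/(P i u); have := IH (ltnW im).
  by rewrite -[positions (s^~ u)]/(P^~ u); lra.
have vPsi u i k : (i < m)%N -> (k < m)%N ->
    (Pn_poly n (Psi u).1).[x i u] - (Pn_poly n (Psi u).1).[x k u] = y i u - y k u.
  move=> im km; have dq : (Pn_poly n (Psi u).1)^`() = (pcrit cr (x^~ u))^`().
    by rewrite dPsi deriv_pcrit scr.
  rewrite (deriv_eq_diff _ _ dq).
  have := @pcrit_shift R cr (P^~ u) (a u) (P i u) (P k u); rewrite -/(x i u) -/(x k u).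
  rewrite -[fun _ => _ + _]/(x^~ u) => ->.
  by have := dy u i im; have := dy u k km; lra.
exists Psi; split.
- move=> u; apply: (@cvg_pair _ _ _ (nbhs u) (nbhs (Psi u).1) (nbhs (Psi u).2)).
    by apply: cont_row => i; apply: cont_pcrit.
  by apply: cont_row => j.
- move=> u; exists (x^~ u) => /=; split => //.
  + exact: dPsi.
  + by move=> j; rewrite mxE.
  + by move=> i k im km; rewrite -subr_lt0 (vPsi u) // subr_lt0 yo.
move=> u p x' xi' dp pb pv p1.
(* Conversely, the spacings of [p] are forced by the uniqueness half of [solve_spacings], and its
   translation by the sum of its critical points or by [a0]. *)
pose s' i := if (i.+1 < m)%N then x' i.+1 - x' i else 1.
have s'0 i : 0 < s' i.
  by rewrite /s'; case: ifP => // im; rewrite subr_gt0 xi' // ltnSn.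
have ps' i : (i < m)%N -> positions s' i = x' i + (- x' 0%N).
  elim: i => [|i IH] im; first by rewrite /positions big_ord0 subrr.
  by rewrite positionsS IH ?(ltnW im) // /s' im; ring.
have ss' : forall i, (i.+1 < m)%N -> s' i = s i u.
  apply: (un s' (s^~ u)) => // i _ im; rewrite sg // /h im.
  rewrite (eq_gap crm im ps') gap_shift /gap.
  rewrite -pv ?(ltnW im) //; congr (_ * _); apply: deriv_eq_diff.
  by rewrite deriv_pcrit scr dp.
have Px i : (i < m)%N -> P i u = x' i - x' 0%N.
  move=> im; rewrite -ps' //; apply: eq_positions => k ki; rewrite ss' //.
  exact: leq_ltn_trans im.
have ax : a u = x' 0%N.
  rewrite /a; case: eqP => [/p1//|/eqP n1].
  have c0 : size cr != 0%N by move: n1; rewrite -scr.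
  have : \sum_(k <- cr) x' k = 0.
    apply/eqP; rewrite -oppr_eq0 -dcrit_coef_sum //; apply/eqP.
    have := congr1 (fun q : {poly R} => q`_(size cr).-1) dp.
    rewrite coefZ coef_deriv coef_Pn0 //; last by right; lia.
    rewrite mul0rn => /esym/eqP; rewrite mulf_eq0 pnatr_eq0 => /orP[|/eqP//]; lia.
  have -> : \sum_(k <- cr) P k u = \sum_(k <- cr) (x' k - x' 0%N).
    by rewrite !big_seq; apply: eq_bigr => k /(allP crm) km; apply: Px.
  rewrite sumrB big_const_seq count_predT iter_addr_0 => ->.
  by rewrite sub0r opprK -[_ *+ _]mulr_natr mulfK // pnatr_eq0.
have xx i : (i < m)%N -> x i u = x' i.
  by move=> im; rewrite /x Px // ax subrK.
have ep : pcrit cr (x^~ u) = pcrit cr x'.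
  by rewrite /pcrit (@eq_dcrit _ _ (x^~ u) x') // => k /(allP crm) /xx.
rewrite [p]surjective_pairing /Psi ep; congr pair.
  apply/rowP => i; rewrite mxE -(coef_Pn_lam n0); have il := ltn_ord i.
  have -> : (n - 2 - i = (n - 2 - i).-1.+1)%N by lia.
  apply/esym; move: (_.-1); apply/deriv_Pn_eq => //.
  by rewrite dp deriv_pcrit scr.
apply/rowP => j; rewrite mxE pb xx //.
have : nth 0%N b j \in b by rewrite mem_nth // sb.
by rewrite (perm_mem pB) mem_reg_pos => /andP[].
Qed.

Lemma has_type_nonempty tau : tau \in types n l -> (0 < (n + l).-1)%N ->
  has_type R n l tau !=set0.
Proof.
case: tau => w b tw m0.
have [|||Psi [_ h _]] := @realize w b R (fun i _ => (nth 0%N w i)%:R) (fun=> 0) tw m0.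
- by move=> i; apply: cont_cst.
- exact: cont_cst.
- by move=> u i k _ _; rewrite ltr_nat.
by exists (Psi 0).
Qed.

(** Values ordered as in [w] form a convex set. Interpolating linearly between the values of two
    morsifications and applying [realize] gives a path, whose ends are the given ones by
    uniqueness. *)
Lemma connected_has_type tau : tau \in types n l -> (0 < (n + l).-1)%N ->
  connected (has_type R n l tau).
Proof.
case: tau => w b tw m0; set A := has_type R n l (w, b).
have [p [xp [xpi dp bp vp]]] := has_type_nonempty tw m0.
have Ap : A p by exists xp.
suff -> : A = connected_component A p by exact: component_connected.
apply/seteqP; split => [q [xq [xqi dq bq vq]]|]; last exact: connected_component_sub.
rewrite /= in xpi dp bp vp xqi dq bq vq.
(* Clamping the parameter to [0, 1] makes the family defined and continuous on the whole line. *)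
pose c (t : R) := Num.max 0 (Num.min 1 t).
have cc : continuous c.
  move=> t; apply: continuous_max; first exact: cvg_cst.
  by apply: continuous_min; [exact: cvg_cst|exact: cvg_id].
have c01 t : 0 <= c t <= 1.
  by rewrite /c le_max lexx ge_max ler01 ge_min lexx.
have mixc (u v : R) : continuous (fun t => (1 - c t) * u + c t * v).
  apply: contD; apply: contM => //; try exact: cont_cst.
  by apply: contB => //; exact: cont_cst.
pose y i t := (1 - c t) * (Pn_poly n p.1).[xp i] + c t * (Pn_poly n q.1).[xq i].
have [|||Psi [cPsi hPsi uPsi]] :=
    @realize w b R y (fun t => (1 - c t) * xp 0%N + c t * xq 0%N) tw m0.
- by move=> i; apply: mixc.
- exact: mixc.
- move=> t i k im km; have /andP[c0 c1] := c01 t.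
  have lt i' k' : (i' < size w)%N -> (k' < size w)%N ->
      (nth 0%N w i' < nth 0%N w k')%N -> y i' t < y k' t.
    move=> im' km' h; have := vp i' k' im' km'; have := vq i' k' im' km'.
    rewrite h /y => hq hp; move: c0; rewrite le_eqVlt => /orP[/eqP<-|c0].
      by rewrite subr0 !mul1r !mul0r !addr0.
    by apply: ler_ltD; [rewrite ler_wpM2l ?subr_ge0 // ltW|rewrite ltr_pM2l].
  apply/idP/idP => [|/lt->//]; apply: contraTT; rewrite -leqNgt leq_eqVlt.
  move=> /orP[/eqP e|/lt h]; first by rewrite (type_nth_inj tw km im e) ltxx.
  by rewrite -leNgt ltW // h.
have c0 : c 0 = 0 by rewrite /c (min_idPr _) ?ler01 // maxxx.
have c1 : c 1 = 1 by rewrite /c minxx (max_idPr _) ?ler01.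
have P0 : Psi 0 = p.
  apply: (uPsi 0 p xp) => //.
    by move=> i k _ _; rewrite /y c0; ring.
  by rewrite c0 => _; ring.
have P1 : Psi 1 = q.
  apply: (uPsi 1 q xq) => //.
    by move=> i k _ _; rewrite /y c1; ring.
  by rewrite c1 => _; ring.
have CI : connected (Psi @` `[0, 1]).
  apply: connected_continuous_connected; first exact: segment_connected.
  exact: continuous_subspaceT.
apply: (connected_component_max _ _ CI).
- by exists 0 => //=; rewrite in_itv /= lexx ler01.
- by move=> _ [t _ <-]; apply: hPsi.
- by exists 1 => //=; rewrite in_itv /= lexx ler01.
Qed.

End Realization.

(** * Counting the components *)

Lemma components_of_partition (T : topologicalType) (I : eqType) (s : seq I)
    (A : I -> set T) (X : set T) :
  {in s, forall i, open (A i)} -> {in s, forall i, connected (A i)} ->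
  {in s, forall i, A i !=set0} ->
  {in s &, forall i j p, A i p -> A j p -> i = j} ->
  {in s, forall i, A i `<=` X} ->
  (forall p, X p -> exists2 i, i \in s & A i p) ->
  components X = [set` map A s].
Proof.
move=> oA cA nA dA sA cov.
have compE i p : i \in s -> A i p -> connected_component X p = A i.
  move=> si Aip; apply/seteqP; split; last first.
    by apply: connected_component_max => //; [exact: sA|exact: cA].
  have sub := @connected_component_sub _ X p.
  have Xp : X p := sA i si p Aip.
  (* Within the component, [A i] is open, and also closed since its complement there is covered by
     the other open parts. *)
  have <- : connected_component X p `&` A i = connected_component X p.
    apply: (@component_connected _ X p).
    - by exists p; split=> //; apply: connected_component_refl.
    - by exists (A i) => //; apply: oA.
    exists (~` \bigcup_(j in [set j | (j \in s) && (j != i)]) A j).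
      by apply: open_closedC; apply: bigcup_open => j /andP[sj _]; apply: oA.
    apply/seteqP; split => q [Cq].
      move=> Aiq; split=> // -[j /andP[sj ji] Ajq].
      by move: ji; rewrite (dA j i sj si q) ?eqxx.
    move=> nq; split=> //; have [j sj Ajq] := cov q (sub q Cq).
    have [<- //|ji] := eqVneq j i.
    by exfalso; apply: nq; exists j => //; apply/andP.
  by move=> q [].
apply/seteqP; split => [_ [p Xp <-]|B /= /mapP[i si ->]].
  by have [i si Aip] := cov p Xp; rewrite (compE i) //= map_f.
have [p Aip] := nA i si.
by exists p; [exact: sA Aip|exact: compE].
Qed.

Lemma components_very_nice (R : realType) n l : (0 < (n + l).-1)%N ->
  components (very_nice_M R n l) = [set` map (has_type R n l) (types n l)].
Proof.
move=> m0; case: (posnP n) => [e|n0]; last first.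
  apply: components_of_partition => [tau|tau|tau|tau tau'|tau|p].
  - exact: open_has_type.
  - by move=> tt; apply: connected_has_type.
  - by move=> tt; apply: has_type_nonempty.
  - by move=> tt tt' p; apply: has_type_inj.
  - by move=> tt p; apply: has_type_very_nice.
  - exact: very_nice_has_type.
(* For [n = 0] there is no type because [laps] is a successor, and no very nice morsification
   because [l] is at least 2 while all boundary values are 0. *)
subst n; have -> : types 0 l = [::].
  case E : (types 0 l) => [//|[w b] s].
  by have /typesP[_] : (w, b) \in types 0 l by rewrite E mem_head.
rewrite (_ : very_nice_M R 0 l = set0).
  by apply/seteqP; split => B /= => [[p]|].
apply/seteqP; split => // p [cs _].
have l1 : (1 < l)%N by lia.
have l0 : (0 < l)%N by lia.
rewrite cat_uniq => /and3P[_ _ us].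
have se := size_enum_ord l; move: (enum 'I_l) se us => e se us.
have := nth_uniq 0 (i := 0%N) (j := 1%N) _ _ us.
rewrite size_map se => /(_ l0 l1).
rewrite !(nth_map (Ordinal l0)) ?se //.
by rewrite /Pn_poly /= !horner0 eqxx.
Qed.

Lemma finite_components (R : realType) n l : (0 < (n + l).-1)%N ->
  finite_set (components (very_nice_M R n l)).
Proof. by move=> m0; rewrite components_very_nice //; apply: finite_seq. Qed.

Lemma K_num_words (R : realType) n l : (0 < (n + l).-1)%N ->
  K R n l = (num_words (n + l).-1 n * l`!)%N.
Proof.
move=> m0; rewrite /K components_very_nice //.
set s := map _ _.
have -> : [set` s] = [set` [fset x in s]%fset].
  by apply/seteqP; split => x /=; rewrite inE.
rewrite set_fsetK card_fseq undup_id ?size_map ?size_types //.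
(* Distinct types give distinct sets, these being nonempty and disjoint, so no component is listed
   twice. *)
rewrite map_inj_in_uniq ?uniq_types // => tau tau' tt tt' e.
case: (posnP n) => [n0|n0].
  by case: tau tt {e} => w b /typesP[_]; rewrite n0.
have [p h] := @has_type_nonempty R n l n0 tau tt m0.
by apply: (has_type_inj n0 tt tt' h); rewrite -e.
Qed.

Theorem theorem3p1 (R : realType) (n l : nat) (hn : (2 <= n)%N) (hl : (1 <= l)%N) :
  [/\ finite_set (components (very_nice_M R (n - 2) (l + 1))),
      finite_set (components (very_nice_M R n l)),
      finite_set (components (very_nice_M R n (l - 1))) &
      (K R (n - 2) (l + 1))%:Z
        = (K R n l)%:Z - n%:Z * l%:Z * (K R n (l - 1))%:Z].
Proof.
have [m0 m1 m2] : [/\ 0 < (n - 2 + (l + 1)).-1, 0 < (n + l).-1 &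
    0 < (n + (l - 1)).-1]%N by split; lia.
split; try exact: finite_components.
rewrite !K_num_words //.
(* The two other terms both concern [m = n + l - 2] marked points, one fewer than [K R n l]. In the
   recurrence [m + 3 - n] is [l.+1], which turns the factorial of [l] into that of [l.+1]. *)
have [m [em em0]] : exists m, (n + l).-1 = m.+1 /\ (0 < m)%N.
  by exists (n + l).-2; lia.
have -> : (n - 2 + (l + 1)).-1 = m by lia.
have -> : (n + (l - 1)).-1 = m by lia.
rewrite em num_wordsS // addn1 factS.
have -> : l`! = (l * (l - 1)`!)%N by case: (l) hl => // k _; rewrite factS subn1.
have -> : (m + 3 - n = l.+1)%N by lia.
set a := num_words m n; set b := num_words m _; set f := _`!.
rewrite !PoszM !PoszD !PoszM; ring.
Qed.
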